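(* For all $\Phi\cup\{\varphi\}\subseteq Fm(C)$: $\Phi\Vdash_3\varphi\Leftrightarrow\Phi\vdash_3\varphi$. (The analogous statements hold for $S4^\forall_\equiv$ and $S5^\forall_\equiv$.)
   Context: Language: $Fm(C)$ is the set of formulas built from propositional variables $V$, a set $C$ of propositional constants containing $\top,\bot$, connectives $\neg,\rightarrow,\vee,\wedge$, identity connective $\equiv$, necessity $\square$ and universal propositional quantifier $\forall$ ($\forall x\varphi$ formed only if $x$ free in $\varphi$). $\varphi[x:=\psi]$ is capture-avoiding substitution; $=_\alpha$ is alpha-congruence. The system $S3^\forall_\equiv$ has axioms: (i) substitution-instances of propositional tautologies; (ii) $\square\varphi\rightarrow\varphi$; (iii) $\square(\varphi\rightarrow\psi)\rightarrow(\square\varphi\rightarrow\square\psi)$; (iv) $\square(\varphi\rightarrow\psi)\rightarrow\square(\square\varphi\rightarrow\square\psi)$; (v) $\varphi\equiv\psi$ if $\varphi=_\alpha\psi$; (vi) $(\varphi\equiv\psi)\rightarrow(\varphi\rightarrow\psi)$; (vii) $(\psi\equiv\psi')\rightarrow(\varphi[x:=\psi]\equiv\varphi[x:=\psi'])$, $x$ free in $\varphi$; (viii) $\forall x(\varphi\equiv\psi)\rightarrow(\forall x\varphi\equiv\forall x\psi)$; (ix) $\forall x\varphi\rightarrow\varphi[x:=\psi]$; (x) $\forall x(\varphi\rightarrow\psi)\rightarrow(\forall x\varphi\rightarrow\forall x\psi)$; (xi) $\forall x(\varphi\rightarrow\psi)\rightarrow(\varphi\rightarrow\forall x\psi)$,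 $x$ not free in $\varphi$; (xii) $\square\forall x\varphi\rightarrow\forall x\square\varphi$; (xiii) $\forall x\square\varphi\rightarrow\square\forall x\varphi$; closed under: $\varphi$ axiom and $x$ free in $\varphi$ implies $\forall x\varphi$ axiom. Rules: Modus Ponens and Axiom Necessitation (from an axiom $\varphi$ infer $\square\varphi$). $\vdash_3$ is derivability in $S3^\forall_\equiv$; $S4^\forall_\equiv$ adds $\square\varphi\rightarrow\square\square\varphi$, $S5^\forall_\equiv$ further adds $\neg\square\varphi\rightarrow\square\neg\square\varphi$. Semantics: a propositional domain is $\mathcal{M}=(M,\mathit{TRUE},\mathit{NEC},f_\bot,f_\top,f_\square,f_\neg,f_\vee,f_\wedge,f_\rightarrow,f_\equiv,f_\forall,\varGamma)$ with $\mathit{TRUE},\mathit{NEC}\subseteq M$, operations of obvious arities, $f_\forall\colon M^M\to M$, $\varGamma\colon C\to M$ with $\varGamma(\bot)=f_\bot,\varGamma(\top)=f_\top$; assignments $\gamma\colon V\to M$ extend homomorphically with $\gamma(c)=\varGamma(c)$ and $\gamma(\forall x\varphi)=f_\forall(m\mapsto\gamma_x^m(\varphi))$. $t\colon M\to M$ is $(\varphi,x,\gamma)$-definable if $t(m)=\gamma_x^m(\varphi)$ for all $m$ (definable if so for some $\varphi,x,\gamma$). With $a\le_\mathcal{M}b:\Leftrightarrow f_\rightarrow(a,b)\in\mathit{NEC}$ and $\approx_\mathcal{M}$ its symmetric part, $\mathcal{M}$ is an $S3^\forall_\equiv$-model if: (1) when $\mathit{NEC}\neq\varnothing$, $\le_\mathcal{M}$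 is a preorder making $(M,f_\bot,f_\top,f_\neg,f_\vee,f_\wedge,f_\rightarrow,\le_\mathcal{M})$ a Boolean prealgebra ($\approx_\mathcal{M}$ a congruence with Boolean-algebra quotient ordered by $\le_\mathcal{M}$); (2) $f_\bot\notin\mathit{TRUE}$, $f_\top\in\mathit{TRUE}$, classical truth conditions for $f_\rightarrow,f_\neg,f_\wedge,f_\vee$, $f_\square(a)\in\mathit{TRUE}\Leftrightarrow a\in\mathit{NEC}$, $f_\equiv(a,b)\in\mathit{TRUE}\Leftrightarrow a=b$, $f_\forall(t)\in\mathit{TRUE}$ for definable $t$ with image in $\mathit{TRUE}$; (3) when $\mathit{NEC}\neq\varnothing$, $\mathit{NEC}\subseteq\mathit{TRUE}$ is upward closed under $\le_\mathcal{M}$ and closed under $f_\wedge$; (4) when $\mathit{NEC}\neq\varnothing$: $f_\top\le_\mathcal{M}f_\equiv(a,a)$; $f_\equiv(a,b)\le_\mathcal{M}f_\rightarrow(a,b)$; $f_\equiv(a,b)\le_\mathcal{M}f_\equiv(t(a),t(b))$ for definable $t$; $f_\square(a)\le_\mathcal{M}a$; $f_\square(f_\rightarrow(a,b))\le_\mathcal{M}f_\rightarrow(f_\square(a),f_\square(b))$; $f_\square(f_\rightarrow(a,b))\le_\mathcal{M}f_\square(f_\rightarrow(f_\square(a),f_\square(b)))$; $f_\forall(t)\le_\mathcal{M}f_\equiv(f_\forall(t_1),f_\forall(t_2))$ and $f_\forall(t)\le_\mathcal{M}f_\rightarrow(f_\forall(t_1),f_\forall(t_2))$ for $t_1,t_2$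 $(\varphi,x,\gamma)$-, $(\psi,x,\gamma)$-definable and $t$ the pointwise $f_\equiv$, resp. $f_\rightarrow$, of $t_1,t_2$; $f_\forall(t)\le_\mathcal{M}t(a)$ for definable $t$; $f_\forall(t)\le_\mathcal{M}f_\rightarrow(b,f_\forall(t'))$ for $t'$ $(\psi,x,\gamma)$-definable, $b$ the denotation of a sentence and $t(a)=f_\rightarrow(b,t'(a))$; $f_\square(f_\forall(t))\approx_\mathcal{M}f_\forall(a\mapsto f_\square(t(a)))$ for definable $t$; $f_\forall(t)\in\mathit{NEC}$ for definable $t$ with image in $\mathit{NEC}$. It is normal if $\mathit{NEC}\neq\varnothing$. A normal $S3^\forall_\equiv$-model is an $S4^\forall_\equiv$-model if $f_\square(a)\le_\mathcal{M}f_\square(f_\square(a))$ for all $a$; an $S4^\forall_\equiv$-model is an $S5^\forall_\equiv$-model if $f_\neg(f_\square(a))\le_\mathcal{M}f_\square(f_\neg(f_\square(a)))$ for all $a$. $(\mathcal{M},\gamma)\vDash\varphi:\Leftrightarrow\gamma(\varphi)\in\mathit{TRUE}$. $\Phi\Vdash_3\varphi$ iff for all normal $S3^\forall_\equiv$-models $\mathcal{M}$ and assignments $\gamma$, $(\mathcal{M},\gamma)\vDash\Phi$ implies $(\mathcal{M},\gamma)\vDash\varphi$ (analogously $\Vdash_4,\Vdash_5$).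
   Formalization: Two model clauses in (4) are corrected, since literally the theorem fails: f_∀(t) ≤ f_≡(f_∀(t1), f_∀(t2)) is required only when x is free in both defining formulas, and in the clause for axiom (xi) b is the denotation of any formula without x free, not only of a closed sentence. *)

(* Defs.v *)
From mathcomp Require Import all_boot.
From mathcomp Require Import boolp classical_sets.

Set Implicit Arguments.
Unset Strict Implicit.
Unset Printing Implicit Defensive.

(** * Syntax *)

Record constants := Constants {
  const_sort :> Type;
  ctop : const_sort;
  cbot : const_sort;
  ctop_neq_cbot : ctop <> cbot }.

(** Raw formulas, over the denumerable set [nat] of variables. The raw type
    allows vacuous quantifiers; the formulas of the language are the members
    of [Fm] below. *)
Inductive form (C : constants) : Type :=
| Var of nat
| Cst of C
| Neg of form C
| Imp of form C & form C
| Or of form C & form C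
| And of form C & form C
| Eqv of form C & form C
| Box of form C
| All of nat & form C.

Arguments Var {C} _.
Arguments Cst {C} _.

Fixpoint fv (C : constants) (A : form C) : seq nat :=
  match A with
  | Var x => [:: x]
  | Cst _ => [::]
  | Neg A | Box A => fv A
  | Imp A B | Or A B | And A B | Eqv A B => fv A ++ fv B
  | All x A => [seq y <- fv A | y != x]
  end.

Fixpoint Fm (C : constants) (A : form C) : Prop :=
  match A with
  | Var _ | Cst _ => True
  | Neg A | Box A => Fm A
  | Imp A B | Or A B | And A B | Eqv A B => Fm A /\ Fm B
  | All x A => x \in fv A /\ Fm A
  end.

Definition upd (T : Type) (g : nat -> T) (x : nat) (a : T) : nat -> T :=
  fun y => if y == x then a else g y.

Definition fresh (s : seq nat) : nat := (foldr maxn 0 s).+1.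

(** Simultaneous capture-avoiding substitution; a bound variable is renamed
    only if it would capture a variable of a substituted formula. *)
Fixpoint msubst (C : constants) (s : nat -> form C) (A : form C) : form C :=
  match A with
  | Var x => s x
  | Cst c => Cst c
  | Neg A => Neg (msubst s A)
  | Imp A B => Imp (msubst s A) (msubst s B)
  | Or A B => Or (msubst s A) (msubst s B)
  | And A B => And (msubst s A) (msubst s B)
  | Eqv A B => Eqv (msubst s A) (msubst s B)
  | Box A => Box (msubst s A)
  | All y A =>
      let avoid := flatten [seq fv (s v) | v <- fv A & v != y] in
      let z := if y \in avoid then fresh avoid else y in
      All z (msubst (upd s y (Var z)) A)
  end.

Definition subst (C : constants) (A : form C) (x : nat) (B : form C) : form C :=
  msubst (upd (@Var C) x B) A.

Inductive alpha (C : constants) : form C -> form C -> Prop :=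
| alpha_rename x y A : y \notin fv A ->
    alpha (All x A) (All y (subst A x (Var y)))
| alpha_refl A : alpha A A
| alpha_sym A B : alpha A B -> alpha B A
| alpha_trans A B D : alpha A B -> alpha B D -> alpha A D
| alpha_neg A A' : alpha A A' -> alpha (Neg A) (Neg A')
| alpha_imp A A' B B' : alpha A A' -> alpha B B' ->
    alpha (Imp A B) (Imp A' B')
| alpha_or A A' B B' : alpha A A' -> alpha B B' -> alpha (Or A B) (Or A' B')
| alpha_and A A' B B' : alpha A A' -> alpha B B' ->
    alpha (And A B) (And A' B')
| alpha_eqv A A' B B' : alpha A A' -> alpha B B' ->
    alpha (Eqv A B) (Eqv A' B')
| alpha_box A A' : alpha A A' -> alpha (Box A) (Box A')
| alpha_all x A A' : alpha A A' -> alpha (All x A) (All x A').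

(** * Deductive systems *)

Inductive pform : Type :=
| PVar of nat
| PTop
| PBot
| PNeg of pform
| PImp of pform & pform
| POr of pform & pform
| PAnd of pform & pform.

Fixpoint peval (v : nat -> bool) (p : pform) : bool :=
  match p with
  | PVar n => v n
  | PTop => true
  | PBot => false
  | PNeg p => ~~ peval v p
  | PImp p q => peval v p ==> peval v q
  | POr p q => peval v p || peval v q
  | PAnd p q => peval v p && peval v q
  end.

Definition tautology (p : pform) : Prop := forall v, peval v p.

Fixpoint pinst (C : constants) (s : nat -> form C) (p : pform) : form C :=
  match p with
  | PVar n => s n
  | PTop => Cst (ctop C)
  | PBot => Cst (cbot C)
  | PNeg p => Neg (pinst s p)
  | PImp p q => Imp (pinst s p) (pinst s q)
  | POr p q => Or (pinst s p) (pinst s q)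
  | PAnd p q => And (pinst s p) (pinst s q)
  end.

Inductive system := S3 | S4 | S5.

Inductive schema (C : constants) (L : system) : form C -> Prop :=
| sch_taut p s : tautology p -> schema L (pinst s p)
| sch_T A : schema L (Imp (Box A) A)
| sch_K A B : schema L (Imp (Box (Imp A B)) (Imp (Box A) (Box B)))
| sch_S3 A B : schema L (Imp (Box (Imp A B)) (Box (Imp (Box A) (Box B))))
| sch_alpha A B : alpha A B -> schema L (Eqv A B)
| sch_eqv_imp A B : schema L (Imp (Eqv A B) (Imp A B))
| sch_eqv_subst A x B B' : x \in fv A ->
    schema L (Imp (Eqv B B') (Eqv (subst A x B) (subst A x B')))
| sch_eqv_all x A B :
    schema L (Imp (All x (Eqv A B)) (Eqv (All x A) (All x B)))
| sch_inst x A B : schema L (Imp (All x A) (subst A x B))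
| sch_all_imp x A B :
    schema L (Imp (All x (Imp A B)) (Imp (All x A) (All x B)))
| sch_all_const x A B : x \notin fv A ->
    schema L (Imp (All x (Imp A B)) (Imp A (All x B)))
| sch_cbarcan x A : schema L (Imp (Box (All x A)) (All x (Box A)))
| sch_barcan x A : schema L (Imp (All x (Box A)) (Box (All x A)))
| sch_4 A : L <> S3 -> schema L (Imp (Box A) (Box (Box A)))
| sch_5 A : L = S5 -> schema L (Imp (Neg (Box A)) (Box (Neg (Box A)))).

(** [Fm A] forces the conditions of formation on the metavariables of the
    schema, e.g. that [x] is free in both formulas of [sch_eqv_all]. *)
Inductive axiom (C : constants) (L : system) : form C -> Prop :=
| axiom_schema A : Fm A -> schema L A -> axiom L A
| axiom_all x A : x \in fv A -> axiom L A -> axiom L (All x A).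

Inductive derives (C : constants) (L : system) (Phi : set (form C)) :
    form C -> Prop :=
| derives_hyp A : Phi A -> derives L Phi A
| derives_axiom A : axiom L A -> derives L Phi A
| derives_mp A B : derives L Phi A -> derives L Phi (Imp A B) ->
    derives L Phi B
| derives_nec A : axiom L A -> derives L Phi (Box A).

(** * Semantics *)

Record domain (C : constants) := Domain {
  dom :> Type;
  TRUE : set dom;
  NEC : set dom;
  f_bot : dom;
  f_top : dom;
  f_box : dom -> dom;
  f_neg : dom -> dom;
  f_or : dom -> dom -> dom;
  f_and : dom -> dom -> dom;
  f_imp : dom -> dom -> dom;
  f_eqv : dom -> dom -> dom;
  f_all : (dom -> dom) -> dom;
  Gamma : C -> dom;
  Gamma_bot : Gamma (cbot C) = f_bot;
  Gamma_top : Gamma (ctop C) = f_top }.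

Arguments TRUE {C} _ _.
Arguments NEC {C} _ _.
Arguments f_bot {C} _.
Arguments f_top {C} _.

Fixpoint den (C : constants) (M : domain C) (g : nat -> M) (A : form C) : M :=
  match A with
  | Var x => g x
  | Cst c => Gamma M c
  | Neg A => f_neg (den g A)
  | Imp A B => f_imp (den g A) (den g B)
  | Or A B => f_or (den g A) (den g B)
  | And A B => f_and (den g A) (den g B)
  | Eqv A B => f_eqv (den g A) (den g B)
  | Box A => f_box (den g A)
  | All x A => f_all (fun m => den (upd g x m) A)
  end.

Definition definable_by (C : constants) (M : domain C)
    (A : form C) (x : nat) (g : nat -> M) (t : M -> M) : Prop :=
  Fm A /\ forall m, t m = den (upd g x m) A.

Definition definable (C : constants) (M : domain C) (t : M -> M) : Prop :=
  exists A x g, definable_by A x g t.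

Definition leM (C : constants) (M : domain C) (a b : M) : Prop :=
  NEC M (f_imp a b).

Definition eqM (C : constants) (M : domain C) (a b : M) : Prop :=
  leM a b /\ leM b a.

(** The laws of a Boolean algebra are imposed on the quotient by [eqM], i.e.
    they are read with [eqM] in place of equality; [bp_le] says that the
    order of the quotient is the one induced by [leM]. *)
Record boolean_prealgebra (C : constants) (M : domain C) : Prop := {
  bp_refl : forall a : M, leM a a;
  bp_trans : forall a b c : M, leM a b -> leM b c -> leM a c;
  bp_cong_neg : forall a a' : M, eqM a a' -> eqM (f_neg a) (f_neg a');
  bp_cong_or : forall a a' b b' : M, eqM a a' -> eqM b b' ->
    eqM (f_or a b) (f_or a' b');
  bp_cong_and : forall a a' b b' : M, eqM a a' -> eqM b b' ->
    eqM (f_and a b) (f_and a' b');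
  bp_cong_imp : forall a a' b b' : M, eqM a a' -> eqM b b' ->
    eqM (f_imp a b) (f_imp a' b');
  bp_orC : forall a b : M, eqM (f_or a b) (f_or b a);
  bp_andC : forall a b : M, eqM (f_and a b) (f_and b a);
  bp_orA : forall a b c : M, eqM (f_or a (f_or b c)) (f_or (f_or a b) c);
  bp_andA : forall a b c : M,
    eqM (f_and a (f_and b c)) (f_and (f_and a b) c);
  bp_or_and : forall a b : M, eqM (f_or a (f_and a b)) a;
  bp_and_or : forall a b : M, eqM (f_and a (f_or a b)) a;
  bp_distr : forall a b c : M,
    eqM (f_and a (f_or b c)) (f_or (f_and a b) (f_and a c));
  bp_bot : forall a : M, eqM (f_or a (f_bot M)) a;
  bp_top : forall a : M, eqM (f_and a (f_top M)) a;
  bp_or_neg : forall a : M, eqM (f_or a (f_neg a)) (f_top M);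
  bp_and_neg : forall a : M, eqM (f_and a (f_neg a)) (f_bot M);
  bp_imp : forall a b : M, eqM (f_imp a b) (f_or (f_neg a) b);
  bp_le : forall a b : M, leM a b <-> eqM (f_and a b) a }.

Record truth_conditions (C : constants) (M : domain C) : Prop := {
  tc_bot : ~ TRUE M (f_bot M);
  tc_top : TRUE M (f_top M);
  tc_imp : forall a b : M, TRUE M (f_imp a b) <-> (TRUE M a -> TRUE M b);
  tc_neg : forall a : M, TRUE M (f_neg a) <-> ~ TRUE M a;
  tc_and : forall a b : M, TRUE M (f_and a b) <-> TRUE M a /\ TRUE M b;
  tc_or : forall a b : M, TRUE M (f_or a b) <-> TRUE M a \/ TRUE M b;
  tc_box : forall a : M, TRUE M (f_box a) <-> NEC M a;
  tc_eqv : forall a b : M, TRUE M (f_eqv a b) <-> a = b;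
  tc_all : forall t : M -> M, definable t -> (forall a, TRUE M (t a)) ->
    TRUE M (f_all t) }.

Record nec_filter (C : constants) (M : domain C) : Prop := {
  nf_true : forall a : M, NEC M a -> TRUE M a;
  nf_up : forall a b : M, NEC M a -> leM a b -> NEC M b;
  nf_and : forall a b : M, NEC M a -> NEC M b -> NEC M (f_and a b) }.

(** In [nc_all_eqv] the variable is required to be free in both formulas, as
    it must be for [All x A] and [All x B] to be formulas. Extended to constant
    functions, which no quantified formula has to denote, the clause would
    validate formulas underivable in S3 and S4. In [nc_all_const], [b] is the denotation of
    any formula without free [x], as in [sch_all_const]; restricted to closed
    formulas, the clause would not validate that schema. *)
Record nec_conditions (C : constants) (M : domain C) : Prop := {
  nc_eqv_refl : forall a : M, leM (f_top M) (f_eqv a a);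
  nc_eqv_imp : forall a b : M, leM (f_eqv a b) (f_imp a b);
  nc_eqv_subst : forall (t : M -> M) (a b : M), definable t ->
    leM (f_eqv a b) (f_eqv (t a) (t b));
  nc_T : forall a : M, leM (f_box a) a;
  nc_K : forall a b : M,
    leM (f_box (f_imp a b)) (f_imp (f_box a) (f_box b));
  nc_S3 : forall a b : M,
    leM (f_box (f_imp a b)) (f_box (f_imp (f_box a) (f_box b)));
  nc_all_eqv : forall (A B : form C) (x : nat) (g : nat -> M) (t1 t2 : M -> M),
    x \in fv A -> x \in fv B ->
    definable_by A x g t1 -> definable_by B x g t2 ->
    leM (f_all (fun a => f_eqv (t1 a) (t2 a))) (f_eqv (f_all t1) (f_all t2));
  nc_all_imp : forall (A B : form C) (x : nat) (g : nat -> M) (t1 t2 : M -> M),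
    definable_by A x g t1 -> definable_by B x g t2 ->
    leM (f_all (fun a => f_imp (t1 a) (t2 a))) (f_imp (f_all t1) (f_all t2));
  nc_inst : forall (t : M -> M) (a : M), definable t -> leM (f_all t) (t a);
  nc_all_const : forall (A B : form C) (x : nat) (g : nat -> M) (b : M)
      (t' : M -> M),
    Fm A -> x \notin fv A -> b = den g A -> definable_by B x g t' ->
    leM (f_all (fun a => f_imp b (t' a))) (f_imp b (f_all t'));
  nc_barcan : forall t : M -> M, definable t ->
    eqM (f_box (f_all t)) (f_all (fun a => f_box (t a)));
  nc_all_nec : forall t : M -> M, definable t -> (forall a, NEC M (t a)) ->
    NEC M (f_all t) }.

Definition normal (C : constants) (M : domain C) : Prop := exists a, NEC M a.

Record S3_model (C : constants) (M : domain C) : Prop := {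
  S3_boolean : normal M -> boolean_prealgebra M;
  S3_truth : truth_conditions M;
  S3_filter : normal M -> nec_filter M;
  S3_nec : normal M -> nec_conditions M }.

Definition S4_model (C : constants) (M : domain C) : Prop :=
  [/\ S3_model M, normal M & forall a : M, leM (f_box a) (f_box (f_box a))].

Definition S5_model (C : constants) (M : domain C) : Prop :=
  S4_model M /\
  forall a : M, leM (f_neg (f_box a)) (f_box (f_neg (f_box a))).

Definition model_of (C : constants) (L : system) (M : domain C) : Prop :=
  match L with
  | S3 => S3_model M
  | S4 => S4_model M
  | S5 => S5_model M
  end.

Definition satisfies (C : constants) (M : domain C) (g : nat -> M)
    (A : form C) : Prop := TRUE M (den g A).

Definition entails (C : constants) (L : system) (Phi : set (form C))
    (A : form C) : Prop :=
  forall (M : domain C) (g : nat -> M), model_of L M -> normal M ->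
    (forall B, Phi B -> satisfies g B) -> satisfies g A.

(* Main.v *)
From HB Require Import structures.
From mathcomp Require Import all_boot zify.
From mathcomp Require Import boolp classical_sets filter.
Require Import Defs.

Set Implicit Arguments.
Unset Strict Implicit.
Unset Printing Implicit Defensive.

Local Open Scope quotient_scope.
Local Open Scope classical_set_scope.

(** Soundness: the axioms denote necessary propositions; for tautologies this
    is Kalmar's lemma in a Boolean prealgebra.

    Completeness is a Henkin construction. The language is extended by
    constants that witness universal formulas and by constants that replace
    the free variables. A formula of the extended language counts as provable
    if it is derivable in the original one after its new constants are replaced
    by sufficiently large variables, so that nothing is captured and no
    substitution ever renames a bound variable. A maximal theory [T] of
    sentences yields a model on the sentences modulo [T (Eqv A B)]. There,
    [f_all t] is the class of [All x A] if [t] is the meaning of a formula [A]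
    in which [x] is actually free, which is well defined by the axiom
    [sch_eqv_all]; any other definable [t] is constant, and [f_all t] is its
    value. *)

HB.instance Definition _ (C : constants) := gen_eqMixin (form C).
HB.instance Definition _ (C : constants) := gen_choiceMixin (form C).

(** * Sets and variables *)

Lemma set_cons (T : eqType) (x : T) (l : seq T) :
  [set` x :: l] = [set` l] `|` [set x].
Proof.
by apply/seteqP; split=> y /=; rewrite inE;
  [case/orP => [/eqP|]; [right|left]|case=> [->|->]; rewrite ?eqxx ?orbT].
Qed.

Lemma finite_subset_chain (T : eqType) (F : set (set T)) (l : seq T) :
  F !=set0 -> total_on F subset -> [set` l] `<=` \bigcup_(S in F) S ->
  exists2 S, F S & [set` l] `<=` S.
Proof.
move=> [S0 FS0] chain; elim: l => [|x l IH]; first by exists S0.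
rewrite set_cons subUset => -[/IH[S FS lS] /(_ x erefl)[S' FS' S'x]].
have [sub|sub] := chain _ _ FS FS'.
  by exists S' => // y [/lS/sub|->].
by exists S => // y [/lS//|->]; apply: sub.
Qed.

Lemma finitary_maximal_extension (T : eqType) (Q : set (set T)) (U S0 : set T) :
  (forall S S', S `<=` S' -> Q S -> Q S') ->
  (forall S, Q S -> exists2 l : seq T, [set` l] `<=` S & Q [set` l]) ->
  S0 `<=` U -> ~ Q S0 ->
  exists S, [/\ S0 `<=` S, S `<=` U, ~ Q S &
    forall x, U x -> ~ S x -> Q (S `|` [set x])].
Proof.
move=> Q_mono Q_fin S0U nQ0.
pose P := [set S : set T | S `<=` U /\ ~ Q (S0 `|` S)].
have [F FP chain|S [[SU nQS] maxS]] := @Zorn_bigcup _ P.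
  split=> [x [S FS Sx]|]; first by have [SU _] := FP S FS; apply: SU.
  have [->|/set0P F0] := eqVneq F set0; first by rewrite bigcup_set0 setU0.
  rewrite setUC -bigcupUl // -[X in Q X](bigcup_image F (setU^~ S0) id).
  move=> /Q_fin [l lF Ql].
  have [_ [S FS <-] lS] : exists2 S, [set S `|` S0 | S in F] S & [set` l] `<=` S.
    apply: finite_subset_chain lF; first by case: F0 => S FS; exists (S `|` S0), S.
    move=> _ _ [S FS <-] [S' FS' <-].
    by case: (chain S S') => // SS'; [left|right]; apply: setSU.
  by have [_] := FP S FS; apply; apply: Q_mono Ql; rewrite setUC.
exists (S0 `|` S); split=> // [|x Ux nx]; first by move=> x [/S0U|/SU].
apply: contrapT => nQ; apply: (maxS (S `|` [set x])).
  by split=> [|/(_ x (or_intror erefl)) Sx]; [exact: subsetUl|apply: nx; right].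
by split=> [y [/SU|->]|] //; rewrite setUA.
Qed.

Lemma fresh_notin (s : seq nat) n : fresh s <= n -> n \notin s.
Proof.
move=> fresh_n; apply: contraL fresh_n => /(nthP 0)[i lt_i <-].
rewrite -ltnNge ltnS; elim: s i lt_i => //= a s IH [|i] lt_i /=; first lia.
by have := IH i lt_i; lia.
Qed.

Section Update.
Variable T : Type.
Implicit Types (g h : nat -> T) (x y : nat) (a : T).

Lemma upd_eq g x a : upd g x a x = a.
Proof. by rewrite /upd eqxx. Qed.

Lemma upd_neq g x a y : y != x -> upd g x a y = g y.
Proof. by rewrite /upd => /negPf ->. Qed.

Lemma upd_id g x : upd g x (g x) = g.
Proof. by apply: funext => y; rewrite /upd; case: eqP => [->|]. Qed.

Lemma eq_in_upd g h x a (s : seq nat) :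
  {in [seq y <- s | y != x], g =1 h} -> {in s, upd g x a =1 upd h x a}.
Proof.
move=> gh y ys; rewrite /upd; case: ifPn => // yx.
by apply: gh; rewrite mem_filter yx.
Qed.

Lemma upd_notin g x a (s : seq nat) : x \notin s -> {in s, upd g x a =1 g}.
Proof. by move=> xs y ys; rewrite upd_neq //; apply: contraNneq xs => <-. Qed.

End Update.

(** * Formulas and substitution *)

Variant unop := UNeg | UBox.
Variant binop := BImp | BOr | BAnd | BEqv.

Definition un (C : constants) (u : unop) (A : form C) : form C :=
  match u with UNeg => Neg A | UBox => Box A end.

Definition bin (C : constants) (o : binop) (A B : form C) : form C :=
  match o with
  | BImp => Imp A B
  | BOr => Or A B
  | BAnd => And A B
  | BEqv => Eqv A B
  end.

Lemma form_connective_ind (C : constants) (P : form C -> Prop) :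
  (forall x, P (Var x)) -> (forall c, P (Cst c)) ->
  (forall u A, P A -> P (un u A)) ->
  (forall o A B, P A -> P B -> P (bin o A B)) ->
  (forall x A, P A -> P (All x A)) ->
  forall A, P A.
Proof.
move=> PVar PCst Pun Pbin PAll.
elim=> [//|//|A PA|A PA B PB|A PA B PB|A PA B PB|A PA B PB|A PA|x A PA].
- exact: (Pun UNeg).
- exact: (Pbin BImp).
- exact: (Pbin BOr).
- exact: (Pbin BAnd).
- exact: (Pbin BEqv).
- exact: (Pun UBox).
- exact: PAll.
Qed.

Fixpoint bv (C : constants) (A : form C) : seq nat :=
  match A with
  | Var _ | Cst _ => [::]
  | Neg A | Box A => bv A
  | Imp A B | Or A B | And A B | Eqv A B => bv A ++ bv B
  | All x A => x :: bv A
  end.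

Fixpoint occurs (C : constants) (c : C) (A : form C) : Prop :=
  match A with
  | Var _ => False
  | Cst d => d = c
  | Neg A | Box A | All _ A => occurs c A
  | Imp A B | Or A B | And A B | Eqv A B => occurs c A \/ occurs c B
  end.

Definition msubst_binder (C : constants) (s : nat -> form C) (y : nat)
    (A : form C) : nat :=
  let avoid := flatten [seq fv (s v) | v <- fv A & v != y] in
  if y \in avoid then fresh avoid else y.

Section Connectives.
Variable C : constants.
Implicit Types A B : form C.

Lemma fv_un u A : fv (un u A) = fv A. Proof. by case: u. Qed.

Lemma fv_bin o A B : fv (bin o A B) = fv A ++ fv B. Proof. by case: o. Qed.

Lemma bv_un u A : bv (un u A) = bv A. Proof. by case: u. Qed.

Lemma bv_bin o A B : bv (bin o A B) = bv A ++ bv B. Proof. by case: o. Qed.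

Lemma Fm_un u A : Fm (un u A) = Fm A. Proof. by case: u. Qed.

Lemma Fm_bin o A B : Fm (bin o A B) = (Fm A /\ Fm B). Proof. by case: o. Qed.

Lemma occurs_un c u A : occurs c (un u A) = occurs c A. Proof. by case: u. Qed.

Lemma occurs_bin c o A B : occurs c (bin o A B) = (occurs c A \/ occurs c B).
Proof. by case: o. Qed.

Lemma msubst_un s u A : msubst s (un u A) = un u (msubst s A).
Proof. by case: u. Qed.

Lemma msubst_bin s o A B : msubst s (bin o A B) = bin o (msubst s A) (msubst s B).
Proof. by case: o. Qed.

Lemma msubst_all s y A : msubst s (All y A) =
  All (msubst_binder s y A) (msubst (upd s y (Var (msubst_binder s y A))) A).
Proof. by []. Qed.

End Connectives.

Section CaptureAvoidingSubstitution.
Variable C : constants.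
Implicit Types (A B : form C) (s : nat -> form C) (u v x y : nat).

Lemma msubst_binder_notin s y A v :
  v \in fv A -> v != y -> msubst_binder s y A \notin fv (s v).
Proof.
move=> vA vy; rewrite /msubst_binder.
set avoid := flatten _; have sub : {subset fv (s v) <= avoid}.
  move=> u us; apply/flattenP; exists (fv (s v)) => //.
  by apply: map_f; rewrite mem_filter vy.
case: ifPn => [_|]; last by apply: contra; apply: sub.
by apply: contra (fresh_notin (leqnn (fresh avoid))); apply: sub.
Qed.

Lemma fv_msubst A s u :
  u \in fv (msubst s A) <-> exists2 v, v \in fv A & u \in fv (s v).
Proof.
elim/form_connective_ind: A s => [x|c|o A IH|o A B IHA IHB|x A IH] s.
- split=> [us|[v]]; first by exists x; rewrite ?inE.
  by rewrite inE => /eqP ->.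
- by split=> // -[].
- by rewrite msubst_un !fv_un.
- rewrite msubst_bin !fv_bin mem_cat; split=> [/orP[/IHA|/IHB] [v vAB us]|[v]].
  + by exists v; rewrite // mem_cat vAB.
  + by exists v; rewrite // mem_cat vAB orbT.
  + rewrite mem_cat => /orP[vA|vB] us; apply/orP.
      by left; apply/IHA; exists v.
    by right; apply/IHB; exists v.
rewrite msubst_all /= mem_filter; set z := msubst_binder s x A.
split=> [/andP[uz /IH[v vA]]|[v]].
  have [->|vx] := eqVneq v x; first by rewrite upd_eq inE (negPf uz).
  by rewrite upd_neq // => us; exists v; rewrite // mem_filter vx.
rewrite mem_filter => /andP[vx vA] us; apply/andP; split.
  by apply: contraTneq us => ->; apply: msubst_binder_notin.
by apply/IH; exists v; rewrite // upd_neq.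
Qed.

Lemma Fm_msubst_inv A s : Fm (msubst s A) -> Fm A.
Proof.
elim/form_connective_ind: A s => [x|c|u A IH|o A B IHA IHB|x A IH] s //.
- by rewrite msubst_un !Fm_un; apply: IH.
- by rewrite msubst_bin !Fm_bin => -[/IHA ? /IHB ?].
rewrite msubst_all => -[/fv_msubst[v vA zv] /IH FA]; split=> //.
have [<- //|vx] := eqVneq v x.
by move: zv; rewrite upd_neq // (negPf (msubst_binder_notin _ vA vx)).
Qed.

Lemma Fm_msubst A s : Fm A -> (forall v, Fm (s v)) -> Fm (msubst s A).
Proof.
elim/form_connective_ind: A s => [x|c|u A IH|o A B IHA IHB|x A IH] s FA Fs //.
- exact: Fs.
- by move: FA; rewrite msubst_un !Fm_un => FA; apply: IH.
- by move: FA; rewrite msubst_bin !Fm_bin => -[FA FB]; split; [apply: IHA|apply: IHB].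
case: FA => xA FA; split; last first.
  by apply: IH => // v; rewrite /upd; case: eqP.
by apply/fv_msubst; exists x; rewrite // upd_eq inE.
Qed.

Lemma fv_subst A x B u : u \in fv (subst A x B) ->
  u \in fv B \/ u \in fv A /\ u != x.
Proof.
move=> /fv_msubst[v vA]; have [->|vx] := eqVneq v x.
  by rewrite upd_eq; left.
by rewrite upd_neq // inE => /eqP ->; right.
Qed.

Lemma mem_fv_subst A x B u : x \in fv A -> u \in fv B -> u \in fv (subst A x B).
Proof. by move=> xA uB; apply/fv_msubst; exists x; rewrite // upd_eq. Qed.

Lemma Fm_subst A x B : Fm A -> Fm B -> Fm (subst A x B).
Proof. by move=> FA FB; apply: Fm_msubst => // v; rewrite /upd; case: eqP. Qed.

Lemma Fm_subst_inv A x B : Fm (subst A x B) -> Fm A.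
Proof. exact: Fm_msubst_inv. Qed.

End CaptureAvoidingSubstitution.

(* Replaces constants and free variables without renaming bound variables;
   the result is meaningful only under [no_capture]. *)
Fixpoint lsubst (C D : constants) (th : C -> form D) (s : nat -> form D)
    (A : form C) : form D :=
  match A with
  | Var x => s x
  | Cst c => th c
  | Neg A => Neg (lsubst th s A)
  | Imp A B => Imp (lsubst th s A) (lsubst th s B)
  | Or A B => Or (lsubst th s A) (lsubst th s B)
  | And A B => And (lsubst th s A) (lsubst th s B)
  | Eqv A B => Eqv (lsubst th s A) (lsubst th s B)
  | Box A => Box (lsubst th s A)
  | All x A => All x (lsubst th (upd s x (Var x)) A)
  end.

Definition rename_below (r : nat -> nat) (m v : nat) : nat :=
  if v < m then r v else v.

Definition free_for (C D : constants) (B : form D) (A : form C) : Prop :=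
  {in bv A, forall y, y \notin fv B}.

Definition no_capture (C D : constants) (th : C -> form D) (s : nat -> form D)
    (A : form C) : Prop :=
  (forall c, free_for (th c) A) /\
  {in fv A, forall v, s v = Var v \/ free_for (s v) A}.

Section LiteralSubstitution.
Variables C D : constants.
Implicit Types (A B : form C) (th : C -> form D) (s : nat -> form D).

Lemma lsubst_un th s u A : lsubst th s (un u A) = un u (lsubst th s A).
Proof. by case: u. Qed.

Lemma lsubst_bin th s o A B :
  lsubst th s (bin o A B) = bin o (lsubst th s A) (lsubst th s B).
Proof. by case: o. Qed.

Lemma free_for_Var z A : z \notin bv A -> free_for (Var z : form D) A.
Proof. by move=> zA y yA; rewrite inE; apply: contraTneq yA => ->. Qed.

Lemma no_capture_un th s u A : no_capture th s (un u A) -> no_capture th s A.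
Proof. by case: u. Qed.

Lemma no_capture_sub th s A B :
  {subset fv B <= fv A} -> {subset bv B <= bv A} ->
  no_capture th s A -> no_capture th s B.
Proof.
move=> fBA bBA [nth ns]; split=> [c y /bBA|v /fBA/ns[->|nv]]; first exact: nth.
  by left.
by right=> y /bBA; apply: nv.
Qed.

Lemma no_capture_bin th s o A B :
  no_capture th s (bin o A B) -> no_capture th s A /\ no_capture th s B.
Proof.
by move=> nAB; split; apply: no_capture_sub nAB => v vAB;
  rewrite ?fv_bin ?bv_bin mem_cat vAB ?orbT.
Qed.

Lemma no_capture_all th s x A : no_capture th s (All x A) ->
  [/\ forall c, x \notin fv (th c), {in fv A, forall v, v != x -> x \notin fv (s v)} &
      no_capture th (upd s x (Var x)) A].
Proof.
move=> [nth ns]; split=> [c|v vA vx|]; first by apply: nth; rewrite inE eqxx.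
  have [|->|] := ns v; first by rewrite /= mem_filter vx.
    by rewrite inE eq_sym.
  by apply; rewrite inE eqxx.
split=> [c y yA|v vA]; first by apply: nth; rewrite inE yA orbT.
have [->|vx] := eqVneq v x; first by rewrite upd_eq; left.
rewrite upd_neq //; have [|->|nv] := ns v; first by rewrite /= mem_filter vx.
  by left.
by right=> y yA; apply: nv; rewrite inE yA orbT.
Qed.

Lemma eq_lsubst th th' s s' A :
  (forall c, occurs c A -> th c = th' c) -> {in fv A, s =1 s'} ->
  lsubst th s A = lsubst th' s' A.
Proof.
elim/form_connective_ind: A s s' => [x|c|u A IH|o A B IHA IHB|x A IH] s s' eth es.
- by apply: es; rewrite inE.
- exact: eth.
- rewrite !lsubst_un; congr un; apply: IH => [c cA|v vA].
    by apply: eth; rewrite occurs_un.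
  by apply: es; rewrite fv_un.
- rewrite !lsubst_bin; congr bin; [apply: IHA|apply: IHB].
  + by move=> c cA; apply: eth; rewrite occurs_bin; left.
  + by move=> v vA; apply: es; rewrite fv_bin mem_cat vA.
  + by move=> c cB; apply: eth; rewrite occurs_bin; right.
  + by move=> v vB; apply: es; rewrite fv_bin mem_cat vB orbT.
by congr All; apply: IH => //; apply: eq_in_upd.
Qed.

Lemma fv_lsubst th s A u : u \in fv (lsubst th s A) ->
  (exists2 v, v \in fv A & u \in fv (s v)) \/ exists c, u \in fv (th c).
Proof.
elim/form_connective_ind: A s => [x|c|o A IH|o A B IHA IHB|x A IH] s.
- by left; exists x; rewrite ?inE.
- by right; exists c.
- by rewrite lsubst_un !fv_un; apply: IH.
- rewrite lsubst_bin !fv_bin mem_cat => /orP[/IHA|/IHB] [[v vAB us]|]; try by right.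
    by left; exists v; rewrite // mem_cat vAB.
  by left; exists v; rewrite // mem_cat vAB orbT.
rewrite /= mem_filter => /andP[ux /IH[[v vA]|]]; last by right.
have [->|vx] := eqVneq v x; first by rewrite upd_eq inE (negPf ux).
by rewrite upd_neq // => us; left; exists v; rewrite // mem_filter vx.
Qed.

Lemma mem_fv_lsubst th s A y :
  s y = Var y -> y \in fv A -> y \in fv (lsubst th s A).
Proof.
elim/form_connective_ind: A s => [x|c|u A IH|o A B IHA IHB|x A IH] s sy //.
- by rewrite inE => /eqP <-; rewrite /= sy inE.
- by rewrite lsubst_un !fv_un; apply: IH.
- rewrite lsubst_bin !fv_bin !mem_cat => /orP[/IHA|/IHB] -> //.
  by rewrite orbT.
rewrite /= !mem_filter => /andP[yx yA]; rewrite yx /=; apply: IH => //.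
by rewrite upd_neq.
Qed.

Lemma Fm_lsubst th s A :
  Fm A -> (forall c, Fm (th c)) -> (forall v, Fm (s v)) -> Fm (lsubst th s A).
Proof.
elim/form_connective_ind: A s => [x|c|u A IH|o A B IHA IHB|x A IH] s FA Fth Fs //=.
- by move: FA; rewrite lsubst_un !Fm_un => FA; apply: IH.
- by move: FA; rewrite lsubst_bin !Fm_bin => -[FA FB]; split; [apply: IHA|apply: IHB].
case: FA => xA FA; split; first by apply: mem_fv_lsubst; rewrite // upd_eq.
by apply: IH => // v; rewrite /upd; case: eqP.
Qed.

Lemma bv_lsubst th s A :
  (forall c, bv (th c) = [::]) -> (forall v, bv (s v) = [::]) ->
  bv (lsubst th s A) = bv A.
Proof.
move=> bth; elim/form_connective_ind: A s => [x|c|u A IH|o A B IHA IHB|x A IH] s bs //=.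
- by rewrite lsubst_un !bv_un IH.
- by rewrite lsubst_bin !bv_bin IHA ?IHB.
by rewrite IH // => v; rewrite /upd; case: eqP.
Qed.

Lemma occurs_lsubst th s A d : occurs d (lsubst th s A) ->
  (exists v, occurs d (s v)) \/ exists2 c, occurs c A & occurs d (th c).
Proof.
elim/form_connective_ind: A s => [x|c|u A IH|o A B IHA IHB|x A IH] s.
- by left; exists x.
- by right; exists c.
- rewrite lsubst_un occurs_un => /IH[|[c cA dc]]; first by left.
  by right; exists c; rewrite ?occurs_un.
- rewrite lsubst_bin occurs_bin => -[/IHA|/IHB] [|[c cA dc]]; try by left.
    by right; exists c; rewrite ?occurs_bin; auto.
  by right; exists c; rewrite ?occurs_bin; auto.
move=> /IH[[v]|]; last by right.
by rewrite /upd; case: eqP => // _; left; exists v.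
Qed.

End LiteralSubstitution.

Lemma lsubst_comp (B C D : constants) (A : form B) (th' : B -> form C)
    (th : C -> form D) s' s :
  no_capture th' s' A ->
  lsubst th s (lsubst th' s' A) =
  lsubst (lsubst th s \o th') (lsubst th s \o s') A.
Proof.
elim/form_connective_ind: A s s' => [x|c|u A IH|o A E IHA IHE|x A IH] s s' //.
- by move=> /no_capture_un nA; rewrite !lsubst_un IH.
- by move=> /no_capture_bin[nA nE]; rewrite !lsubst_bin IHA ?IHE.
move=> /no_capture_all[xth xs' nA] /=; rewrite IH //; congr All.
apply: eq_lsubst => [c _|v vA] /=; first by apply: eq_lsubst => //; apply: upd_notin.
have [->|vx] := eqVneq v x; first by rewrite !upd_eq /= upd_eq.
by rewrite !upd_neq //=; apply: eq_lsubst => //; apply: upd_notin; apply: xs'.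
Qed.

Section SingleSubstitution.
Variable C : constants.
Implicit Types (A B : form C) (s : nat -> form C) (x y : nat).

Lemma lsubst_id s A : {in fv A, s =1 Var} -> lsubst Cst s A = A.
Proof.
elim/form_connective_ind: A s => [x|c|u A IH|o A B IHA IHB|x A IH] s es //=.
- by apply: es; rewrite inE.
- by rewrite lsubst_un IH // => v vA; apply: es; rewrite fv_un.
- by rewrite lsubst_bin IHA ?IHB // => v vAB; apply: es;
    rewrite fv_bin mem_cat vAB ?orbT.
rewrite IH // => v vA; rewrite -[RHS](congr1 (@^~ v) (upd_id Var x)).
exact: eq_in_upd es v vA.
Qed.

Lemma msubst_lsubst s A : no_capture Cst s A -> msubst s A = lsubst Cst s A.
Proof.
elim/form_connective_ind: A s => [x|c|u A IH|o A B IHA IHB|x A IH] s //.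
- by move=> /no_capture_un nA; rewrite msubst_un lsubst_un IH.
- by move=> /no_capture_bin[nA fB]; rewrite msubst_bin lsubst_bin IHA ?IHB.
move=> /no_capture_all[_ xs nA]; rewrite msubst_all /msubst_binder ifN ?IH //.
apply/flattenP => -[fvs /mapP[v]]; rewrite mem_filter => /andP[vx vA] ->.
by rewrite (negPf (xs v vA vx)).
Qed.

Lemma msubst_id s A : {in fv A, s =1 Var} -> msubst s A = A.
Proof.
by move=> es; rewrite msubst_lsubst ?lsubst_id //; split=> // v /es; left.
Qed.

Lemma subst_Var A x : subst A x (Var x) = A.
Proof. by apply: msubst_id => v _; rewrite upd_id. Qed.

Lemma subst_notin A x B : x \notin fv A -> subst A x B = A.
Proof. by move=> xA; apply: msubst_id; apply: upd_notin. Qed.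

Lemma no_capture_subst A x B :
  free_for B A -> no_capture Cst (upd Var x B) A.
Proof. by move=> fB; split=> // v _; rewrite /upd; case: eqP; auto. Qed.

Lemma subst_lsubst A x B :
  free_for B A -> subst A x B = lsubst Cst (upd Var x B) A.
Proof. by move=> fB; apply/msubst_lsubst/no_capture_subst. Qed.

Lemma bv_subst A x B :
  free_for B A -> bv B = [::] -> bv (subst A x B) = bv A.
Proof.
move=> fB bB; rewrite subst_lsubst // bv_lsubst // => v.
by rewrite /upd; case: eqP.
Qed.

Lemma subst_rename A x z B : z \notin fv A -> z \notin bv A -> free_for B A ->
  subst (subst A x (Var z)) z B = subst A x B.
Proof.
move=> zA /(@free_for_Var C C) fz fB.
have fB' : free_for B (subst A x (Var z)) by rewrite /free_for bv_subst.
rewrite (subst_lsubst _ fB') !subst_lsubst // lsubst_comp; last exact: no_capture_subst.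
apply: eq_lsubst => //= v vA.
have [->|vx] := eqVneq v x; first by rewrite !upd_eq /= upd_eq.
by rewrite !upd_neq //= (upd_notin _ _ zA).
Qed.

Lemma no_capture_rename (r : nat -> nat) A :
  (forall v, r v = v \/ r v \notin bv A) -> no_capture Cst (@Var C \o r) A.
Proof.
by move=> r_bv; split=> // v _ /=; case: (r_bv v) => [->|/free_for_Var]; auto.
Qed.

Lemma lsubst_rename_belowS (r : nat -> nat) m A :
  (forall v, r v \notin fv A) -> (forall v, r v \notin bv A) -> m \in fv A ->
  lsubst Cst (Var \o rename_below r m.+1) A =
  subst (lsubst Cst (Var \o rename_below r m) A) m (Var (r m)).
Proof.
move=> r_fv r_bv mA; have fr : free_for (Var (r m) : form C) A by apply: free_for_Var.
rewrite subst_lsubst /free_for ?bv_lsubst // lsubst_comp; last first.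
  by apply: no_capture_rename => v; rewrite /rename_below; case: ifP; auto.
apply: eq_lsubst => //= v vA; rewrite /rename_below ltnS leq_eqVlt /upd.
have [->|vm] /= := eqVneq v m; first by rewrite ltnn eqxx.
case: ifP => _; last by rewrite (negPf vm).
by case: eqP mA => // <-; rewrite (negPf (r_fv v)).
Qed.

Lemma occurs_subst A x B c : free_for B A ->
  occurs c (subst A x B) -> occurs c A \/ occurs c B.
Proof.
move=> fB; rewrite subst_lsubst // => /occurs_lsubst[[v]|[d dA <-]]; last by left.
by rewrite /upd; case: eqP => // _; right.
Qed.

End SingleSubstitution.

(** * Denotations *)

Definition f_un (C : constants) (M : domain C) (u : unop) (a : M) : M :=
  match u with UNeg => f_neg a | UBox => f_box a end.

Definition f_bin (C : constants) (M : domain C) (o : binop) (a b : M) : M :=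
  match o with
  | BImp => f_imp a b
  | BOr => f_or a b
  | BAnd => f_and a b
  | BEqv => f_eqv a b
  end.

Fixpoint pdenote (C : constants) (M : domain C) (s : nat -> M) (p : pform) : M :=
  match p with
  | PVar n => s n
  | PTop => f_top M
  | PBot => f_bot M
  | PNeg p => f_neg (pdenote s p)
  | PImp p q => f_imp (pdenote s p) (pdenote s q)
  | POr p q => f_or (pdenote s p) (pdenote s q)
  | PAnd p q => f_and (pdenote s p) (pdenote s q)
  end.

Section Denotation.
Variables (C : constants) (M : domain C).
Implicit Types (A B : form C) (g h : nat -> M) (x : nat) (m : M).

Lemma den_un g u A : den g (un u A) = f_un u (den g A). Proof. by case: u. Qed.

Lemma den_bin g o A B : den g (bin o A B) = f_bin o (den g A) (den g B).
Proof. by case: o. Qed.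

Lemma eq_den g h A : {in fv A, g =1 h} -> den g A = den h A.
Proof.
elim/form_connective_ind: A g h => [x|c|u A IH|o A B IHA IHB|x A IH] g h gh.
- by apply: gh; rewrite inE.
- by [].
- by rewrite !den_un (IH g h) // => v vA; apply: gh; rewrite fv_un.
- by rewrite !den_bin (IHA g h) ?(IHB g h) // => v vAB; apply: gh;
    rewrite fv_bin mem_cat vAB ?orbT.
by congr f_all; apply: funext => m; apply/IH/eq_in_upd.
Qed.

Lemma den_upd_notin g x m A : x \notin fv A -> den (upd g x m) A = den g A.
Proof. by move=> xA; apply/eq_den/upd_notin. Qed.

Lemma den_msubst g s A : den g (msubst s A) = den (den g \o s) A.
Proof.
elim/form_connective_ind: A s g => [x|c|u A IH|o A B IHA IHB|x A IH] s g //.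
- by rewrite msubst_un !den_un IH.
- by rewrite msubst_bin !den_bin IHA IHB.
rewrite msubst_all /=; congr f_all; apply: funext => m; rewrite IH.
apply: eq_den => v vA /=.
have [->|vx] := eqVneq v x; first by rewrite !upd_eq /= upd_eq.
by rewrite !upd_neq //= den_upd_notin // msubst_binder_notin.
Qed.

Lemma den_subst g A x B : den g (subst A x B) = den (upd g x (den g B)) A.
Proof. by rewrite den_msubst; apply: eq_den => v _ /=; rewrite /upd; case: eqP. Qed.

Lemma den_alpha A B : alpha A B -> forall g, den g A = den g B.
Proof.
elim=> {A B} //=; last by move=> x A A' _ IH g; congr f_all; apply: funext.
- move=> x y A yA g; congr f_all; apply: funext => m.
  rewrite den_subst /= upd_eq; apply: eq_den => v vA.
  have [->|vx] := eqVneq v x; first by rewrite !upd_eq.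
  by rewrite !(upd_neq _ _ vx) (upd_notin _ _ yA).
- by move=> A B D _ IH1 _ IH2 g; rewrite IH1.
- by move=> A A' _ IH g; rewrite IH.
1-4: by move=> A A' B B' _ IH1 _ IH2 g; rewrite IH1 IH2.
by move=> A A' _ IH g; rewrite IH.
Qed.

Lemma den_pinst g s p : den g (pinst s p) = pdenote (den g \o s) p.
Proof.
by elim: p => //= [||p ->|p -> q ->|p -> q ->|p -> q ->] //;
  rewrite ?Gamma_bot ?Gamma_top.
Qed.

Lemma definable_den A x g : Fm A -> definable (fun m => den (upd g x m) A).
Proof. by move=> FA; exists A, x, g. Qed.

End Denotation.

(** * Tautologies and Boolean prealgebras *)

Section BooleanPrealgebra.
Variables (C : constants) (M : domain C) (bpM : boolean_prealgebra M).
Implicit Types a b c e : M.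

Let leMM a : leM a a := bp_refl bpM a.
Let leM_trans a b c : leM a b -> leM b c -> leM a c := @bp_trans _ _ bpM a b c.

Lemma eqM_trans a b c : eqM a b -> eqM b c -> eqM a c.
Proof.
by move=> [ab ba] [bc cb]; split; [apply: leM_trans ab bc|apply: leM_trans cb ba].
Qed.

Lemma leM_orl a b : leM a (f_or a b).
Proof. exact/(bp_le bpM)/(bp_and_or bpM). Qed.

Lemma leM_orr a b : leM b (f_or a b).
Proof. exact: leM_trans (leM_orl b a) (proj1 (bp_orC bpM _ _)). Qed.

Lemma leM_andl a b : leM (f_and a b) a.
Proof. exact: leM_trans (leM_orr a _) (proj1 (bp_or_and bpM _ _)). Qed.

Lemma leM_andr a b : leM (f_and a b) b.
Proof. exact: leM_trans (proj1 (bp_andC bpM _ _)) (leM_andl _ _). Qed.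

Lemma leM_and a b c : leM c a -> leM c b -> leM c (f_and a b).
Proof.
move=> /(bp_le bpM) ca /(bp_le bpM) cb; apply/(bp_le bpM).
apply: eqM_trans (bp_andA bpM _ _ _) _; apply: eqM_trans cb.
by apply: (bp_cong_and bpM) => //; split; apply: leMM.
Qed.

Lemma leM_top a : leM a (f_top M).
Proof. exact/(bp_le bpM)/(bp_top bpM). Qed.

Lemma leM_bot a : leM (f_bot M) a.
Proof. exact: leM_trans (leM_orr a _) (proj1 (bp_bot bpM _)). Qed.

Lemma leM_or a b c : leM a c -> leM b c -> leM (f_or a b) c.
Proof.
move=> /(bp_le bpM) ac /(bp_le bpM) bc; apply/(bp_le bpM).
apply: eqM_trans (bp_andC bpM _ _) _; apply: eqM_trans (bp_distr bpM _ _ _) _.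
by apply: (bp_cong_or bpM); apply: eqM_trans (bp_andC bpM _ _) _.
Qed.

Lemma leM_and_or a b c d :
  leM (f_and a b) d -> leM (f_and a c) d -> leM (f_and a (f_or b c)) d.
Proof.
by move=> abd acd; apply: leM_trans (proj1 (bp_distr bpM _ _ _)) (leM_or abd acd).
Qed.

Lemma leM_by_cases a e b :
  leM (f_and e a) b -> leM (f_and e (f_neg a)) b -> leM e b.
Proof.
move=> ea en; apply: leM_trans (leM_and_or ea en); apply: (leM_and (leMM e)).
exact: leM_trans (leM_top e) (proj2 (bp_or_neg bpM a)).
Qed.

Lemma leM_by_contradiction a e b : leM e a -> leM e (f_neg a) -> leM e b.
Proof.
move=> ea en; apply: leM_trans (leM_and ea en) _.
exact: leM_trans (proj1 (bp_and_neg bpM _)) (leM_bot _).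
Qed.

Lemma leM_neg a e : leM (f_and e a) (f_neg a) -> leM e (f_neg a).
Proof. by move=> h; apply: (@leM_by_cases a) => //; apply: leM_andr. Qed.

Definition literal (v : bool) a : M := if v then a else f_neg a.

Lemma leM_literal_neg v a e :
  leM e (literal v a) -> leM e (literal (~~ v) (f_neg a)).
Proof.
case: v => //= ea; apply: leM_neg.
exact: leM_by_contradiction (leM_trans (leM_andl _ _) ea) (leM_andr _ _).
Qed.

Lemma leM_literal_and v w a b e :
  leM e (literal v a) -> leM e (literal w b) -> leM e (literal (v && w) (f_and a b)).
Proof.
case: v => /= ea; last first.
  move=> _; apply/leM_neg/(@leM_by_contradiction a).
    exact: leM_trans (leM_andr _ _) (leM_andl _ _).
  exact: leM_trans (leM_andl _ _) ea.
case: w => /= eb; first exact: leM_and.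
apply/leM_neg/(@leM_by_contradiction b).
  exact: leM_trans (leM_andr _ _) (leM_andr _ _).
exact: leM_trans (leM_andl _ _) eb.
Qed.

Lemma leM_literal_or v w a b e :
  leM e (literal v a) -> leM e (literal w b) -> leM e (literal (v || w) (f_or a b)).
Proof.
case: v => /= ea; first by move=> _; apply: leM_trans ea (leM_orl _ _).
case: w => /= eb; first exact: leM_trans eb (leM_orr _ _).
apply/leM_neg/leM_and_or.
  exact: leM_by_contradiction (leM_andr _ _) (leM_trans (leM_andl _ _) ea).
exact: leM_by_contradiction (leM_andr _ _) (leM_trans (leM_andl _ _) eb).
Qed.

Lemma leM_literal_eqM v a b e : eqM a b -> leM e (literal v a) -> leM e (literal v b).
Proof.
move=> ab; case: v => /= ea; first exact: leM_trans ea (proj1 ab).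
apply/leM_neg/(@leM_by_contradiction a); last exact: leM_trans (leM_andl _ _) ea.
exact: leM_trans (leM_andr _ _) (proj2 ab).
Qed.

Lemma leM_literal_imp v w a b e :
  leM e (literal v a) -> leM e (literal w b) -> leM e (literal (v ==> w) (f_imp a b)).
Proof.
move=> ea eb; apply: (@leM_literal_eqM _ (f_or (f_neg a) b)).
  by have [] := bp_imp bpM a b.
by rewrite implybE; apply: leM_literal_or => //; apply: leM_literal_neg.
Qed.

Fixpoint pbound (p : pform) : nat :=
  match p with
  | PVar n => n.+1
  | PTop | PBot => 0
  | PNeg p => pbound p
  | PImp p q | POr p q | PAnd p q => maxn (pbound p) (pbound q)
  end.

Lemma kalmar_literal s v p e :
  (forall i, i < pbound p -> leM e (literal (v i) (s i))) ->
  leM e (literal (peval v p) (pdenote s p)).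
Proof.
have sub p' q' : (forall i, i < maxn (pbound p') (pbound q') ->
      leM e (literal (v i) (s i))) ->
    (forall i, i < pbound p' -> leM e (literal (v i) (s i))) /\
    (forall i, i < pbound q' -> leM e (literal (v i) (s i))).
  by move=> h; split=> i lt_i; apply: h; rewrite leq_max lt_i ?orbT.
elim: p => [n|||p IH|p IHp q IHq|p IHp q IHq|p IHp q IHq] /=.
- exact.
- by move=> _; apply: leM_top.
- move=> _; apply/leM_neg; exact: leM_trans (leM_andr _ _) (leM_bot _).
- by move=> /IH; apply: leM_literal_neg.
- by move=> /sub[/IHp ? /IHq ?]; apply: leM_literal_imp.
- by move=> /sub[/IHp ? /IHq ?]; apply: leM_literal_or.
- by move=> /sub[/IHp ? /IHq ?]; apply: leM_literal_and.
Qed.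

(* The hypotheses of Kalmar's lemma are discharged one variable at a time,
   by cases on the value of the variable. *)
Lemma leM_tautology s p e : tautology p -> leM e (pdenote s p).
Proof.
move=> taut; suff elim_vars n v e' :
    (forall i, n <= i < pbound p -> leM e' (literal (v i) (s i))) ->
    leM e' (pdenote s p).
  by apply: (elim_vars (pbound p) xpredT) => i; lia.
elim: n v e' => [|n IH] v e' ev.
  by have := kalmar_literal ev; rewrite taut.
have decided (b : bool) : leM (f_and e' (literal b (s n))) (pdenote s p).
  apply: (IH (upd v n b)) => i /andP[le_ni lt_ip].
  have [->|ni] := eqVneq i n; first by rewrite upd_eq; apply: leM_andr.
  rewrite upd_neq //; apply: leM_trans (leM_andl _ _) (ev i _).
  by rewrite ltn_neqAle eq_sym ni le_ni.
exact: leM_by_cases (decided true) (decided false).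
Qed.

End BooleanPrealgebra.

Local Notation P0 := (PVar 0).
Local Notation P1 := (PVar 1).
Local Notation P2 := (PVar 2).
Local Notation P3 := (PVar 3).

Ltac truth_table :=
  let v := fresh "v" in
  by move=> v /=; case: (v 0); case: (v 1); case: (v 2); case: (v 3).

Section TautologiesNecessary.
Variables (C : constants) (M : domain C).
Hypothesis NEC_tautology :
  forall (s : nat -> M) p, tautology p -> NEC M (pdenote s p).
Hypothesis NEC_mp : forall a b : M, NEC M (f_imp a b) -> NEC M a -> NEC M b.
Implicit Types (a b c : M) (l : seq M).

Let pvalues l : nat -> M := nth (f_top M) l.

Lemma leM_pdenote l p q : tautology (PImp p q) ->
  leM (pdenote (pvalues l) p) (pdenote (pvalues l) q).
Proof. exact: (@NEC_tautology _ (PImp p q)). Qed.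

Lemma eqM_pdenote l p q : tautology (PAnd (PImp p q) (PImp q p)) ->
  eqM (pdenote (pvalues l) p) (pdenote (pvalues l) q).
Proof. by move=> pq; split; apply: leM_pdenote => v; case/andP: (pq v). Qed.

Lemma leM_trans_tautology a b c : leM a b -> leM b c -> leM a c.
Proof.
move=> ab; apply: NEC_mp; apply: NEC_mp ab.
by apply: (@leM_pdenote [:: a; b; c] (PImp P0 P1) (PImp (PImp P1 P2) (PImp P0 P2)));
  truth_table.
Qed.

Lemma leM_NEC a b : NEC M b -> leM a b.
Proof.
by apply: NEC_mp; apply: (@leM_pdenote [:: a; b] P1 (PImp P0 P1)); truth_table.
Qed.

Lemma leM_f_imp a a' b b' : leM a' a -> leM b b' -> leM (f_imp a b) (f_imp a' b').
Proof.
move=> a'a; apply: NEC_mp; apply: NEC_mp a'a.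
by apply: (@leM_pdenote [:: a; a'; b; b'] (PImp P1 P0)
  (PImp (PImp P2 P3) (PImp (PImp P0 P2) (PImp P1 P3)))); truth_table.
Qed.

Lemma eqM_f_neg a a' : eqM a a' -> eqM (f_neg a) (f_neg a').
Proof.
have contrapositive b c : leM b c -> leM (f_neg c) (f_neg b).
  apply: NEC_mp.
  by apply: (@leM_pdenote [:: b; c] (PImp P0 P1) (PImp (PNeg P1) (PNeg P0)));
    truth_table.
by move=> [? ?]; split; apply: contrapositive.
Qed.

Lemma eqM_binary (op : M -> M -> M) (pop : pform -> pform -> pform) :
  (forall s p q, pdenote s (pop p q) = op (pdenote s p) (pdenote s q)) ->
  (forall v p q p' q', peval v p = peval v p' -> peval v q = peval v q' ->
    peval v (pop p q) = peval v (pop p' q')) ->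
  forall a a' b b', eqM a a' -> eqM b b' -> eqM (op a b) (op a' b').
Proof.
move=> den_pop peval_pop.
have leM_op a a' b b' : eqM a a' -> eqM b b' -> leM (op a b) (op a' b').
  move=> [aa' a'a] [bb' b'b]; set s := pvalues [:: a; a'; b; b'].
  have <- : pdenote s (pop P0 P2) = op a b by rewrite den_pop.
  have <- : pdenote s (pop P1 P3) = op a' b' by rewrite den_pop.
  apply: NEC_mp b'b; apply: NEC_mp bb'; apply: NEC_mp a'a; apply: NEC_mp aa'.
  apply: (@NEC_tautology s (PImp (PImp P0 P1) (PImp (PImp P1 P0) (PImp (PImp P2 P3)
    (PImp (PImp P3 P2) (PImp (pop P0 P2) (pop P1 P3))))))) => v /=.
  case E0: (v 0); case E1: (v 1); case E2: (v 2); case E3: (v 3) => //=;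
  by rewrite (peval_pop v P0 P2 P1 P3) ?implybb //= ?E0 ?E1 ?E2 ?E3.
by move=> a a' b b' [? ?] [? ?]; split; apply: leM_op.
Qed.

Lemma leM_and_eqM a b : leM a b <-> eqM (f_and a b) a.
Proof.
split=> [ab|[_ ab]].
  split; first by apply: (@leM_pdenote [:: a; b] (PAnd P0 P1) P0); truth_table.
  apply: NEC_mp ab.
  by apply: (@leM_pdenote [:: a; b] (PImp P0 P1) (PImp P0 (PAnd P0 P1))); truth_table.
apply: leM_trans_tautology ab _.
by apply: (@leM_pdenote [:: a; b] (PAnd P0 P1) P1); truth_table.
Qed.

Lemma boolean_prealgebra_of_tautologies : boolean_prealgebra M.
Proof.
split.
- by move=> a; apply: (@leM_pdenote [:: a] P0 P0); truth_table.
- exact: leM_trans_tautology.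
- exact: eqM_f_neg.
- by apply: (@eqM_binary _ POr) => //= v p q p' q' -> ->.
- by apply: (@eqM_binary _ PAnd) => //= v p q p' q' -> ->.
- by apply: (@eqM_binary _ PImp) => //= v p q p' q' -> ->.
- by move=> a b; apply: (@eqM_pdenote [:: a; b] (POr P0 P1) (POr P1 P0)); truth_table.
- by move=> a b; apply: (@eqM_pdenote [:: a; b] (PAnd P0 P1) (PAnd P1 P0)); truth_table.
- move=> a b c; apply: (@eqM_pdenote [:: a; b; c] (POr P0 (POr P1 P2))
    (POr (POr P0 P1) P2)); truth_table.
- move=> a b c; apply: (@eqM_pdenote [:: a; b; c] (PAnd P0 (PAnd P1 P2))
    (PAnd (PAnd P0 P1) P2)); truth_table.
- by move=> a b; apply: (@eqM_pdenote [:: a; b] (POr P0 (PAnd P0 P1)) P0); truth_table.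
- by move=> a b; apply: (@eqM_pdenote [:: a; b] (PAnd P0 (POr P0 P1)) P0); truth_table.
- move=> a b c; apply: (@eqM_pdenote [:: a; b; c] (PAnd P0 (POr P1 P2))
    (POr (PAnd P0 P1) (PAnd P0 P2))); truth_table.
- by move=> a; apply: (@eqM_pdenote [:: a] (POr P0 PBot) P0); truth_table.
- by move=> a; apply: (@eqM_pdenote [:: a] (PAnd P0 PTop) P0); truth_table.
- by move=> a; apply: (@eqM_pdenote [:: a] (POr P0 (PNeg P0)) PTop); truth_table.
- by move=> a; apply: (@eqM_pdenote [:: a] (PAnd P0 (PNeg P0)) PBot); truth_table.
- by move=> a b; apply: (@eqM_pdenote [:: a; b] (PImp P0 P1) (POr (PNeg P0) P1));
    truth_table.
exact: leM_and_eqM.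
Qed.

End TautologiesNecessary.

(** * Soundness *)

Section Soundness.
Variables (C : constants) (L : system) (M : domain C).
Hypotheses (modelM : model_of L M) (normalM : normal M).
Implicit Types (A B : form C) (g : nat -> M).

Lemma model_of_S3 : S3_model M.
Proof. by case: L modelM => //= [[]|[[]]]. Qed.

Lemma model_of_S4 : L <> S3 -> S4_model M.
Proof. by case: L modelM => //= [[]]. Qed.

Let bpM := S3_boolean model_of_S3 normalM.
Let nfM := S3_filter model_of_S3 normalM.
Let ncM := S3_nec model_of_S3 normalM.

Lemma NEC_leM_top a : leM (f_top M) a -> NEC M a.
Proof.
by have [b Nb] := normalM; apply/(nf_up nfM)/(nf_up nfM Nb); apply: leM_top.
Qed.

Lemma NEC_schema g A : Fm A -> schema L A -> NEC M (den g A).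
Proof.
move=> FA sA; case: sA FA => {A} /=.
- by move=> p s taut _; rewrite den_pinst; apply/NEC_leM_top/leM_tautology.
- by move=> A _; apply: (nc_T ncM).
- by move=> A B _; apply: (nc_K ncM).
- by move=> A B _; apply: (nc_S3 ncM).
- by move=> A B AB _; rewrite (den_alpha AB); apply/NEC_leM_top/(nc_eqv_refl ncM).
- by move=> A B _; apply: (nc_eqv_imp ncM).
- move=> A x B B' xA [_ [/Fm_subst_inv FA _]]; rewrite !den_subst.
  exact: (nc_eqv_subst ncM _ _ (definable_den x g FA)).
- move=> x A B [_ [[xA FA] [xB FB]]]; exact: (nc_all_eqv ncM xA xB (g := g)).
- move=> x A B [[xA FA] _]; rewrite den_subst.
  exact: (nc_inst ncM _ (definable_den x g FA)).
- move=> x A B [_ [[xA FA] [xB FB]]].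
  exact: (nc_all_imp ncM (A := A) (B := B) (x := x) (g := g)).
- move=> x A B xA [_ [FA [xB FB]]].
  under [X in f_imp (f_all X)]funext do rewrite den_upd_notin //.
  by apply: (nc_all_const ncM FA xA (g := g) (B := B)).
- by move=> x A [[xA FA] _]; have [] := nc_barcan ncM (definable_den x g FA).
- by move=> x A [_ [xA FA]]; have [] := nc_barcan ncM (definable_den x g FA).
- by move=> A L3 _; have [_ _] := model_of_S4 L3; apply.
- by move=> A L5 _; move: modelM; rewrite L5 => -[_]; apply.
Qed.

Lemma NEC_axiom A g : axiom L A -> NEC M (den g A).
Proof.
move=> aA; have [] : Fm A /\ forall g, NEC M (den g A); last by [].
elim: aA => {A g} [A FA sA|x A xA _ [FA IH]].
  by split=> // g; apply: NEC_schema.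
by split=> // g; apply: (nc_all_nec ncM (definable_den x g FA)).
Qed.

End Soundness.

Lemma soundness (C : constants) L (Phi : set (form C)) A :
  derives L Phi A -> entails L Phi A.
Proof.
move=> dA M g modelM normalM satPhi; have h3 := model_of_S3 modelM.
elim: dA => {A} [A /satPhi //|A aA|A B _ satA _|A aA].
- exact/(nf_true (S3_filter h3 normalM))/(NEC_axiom modelM).
- by move=> /(tc_imp (S3_truth h3)); apply.
- exact/(tc_box (S3_truth h3))/(NEC_axiom modelM).
Qed.

(** * Derivations *)

Section Derivations.
Variables (C : constants) (L : system).
Implicit Types (Phi Psi : set (form C)) (A B : form C) (x z : nat).

Lemma axiom_Fm A : axiom L A -> Fm A.
Proof. by elim. Qed.

Lemma derives_Fm Phi A : Phi `<=` @Fm C -> derives L Phi A -> Fm A.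
Proof. by move=> FPhi; elim=> {A} [A /FPhi|A /axiom_Fm|A B _ _ _ []|A /axiom_Fm]. Qed.

Lemma derives_mono Phi Psi A : Phi `<=` Psi -> derives L Phi A -> derives L Psi A.
Proof.
move=> sub; elim=> {A} [A /sub|A|A B _ dA _|A]; first exact: derives_hyp.
- exact: derives_axiom.
- exact: derives_mp.
- exact: derives_nec.
Qed.

Lemma derives_schema Phi A : Fm A -> schema L A -> derives L Phi A.
Proof. by move=> FA sA; apply/derives_axiom/axiom_schema. Qed.

Lemma derives_tautology Phi p s :
  tautology p -> Fm (pinst s p) -> derives L Phi (pinst s p).
Proof. by move=> taut Fp; apply/derives_schema/sch_taut. Qed.

Lemma derives_weaken Phi A B :
  Fm A -> Fm B -> derives L Phi B -> derives L Phi (Imp A B).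
Proof.
move=> FA FB dB; apply: derives_mp dB _.
by apply: (@derives_tautology _ (PImp P0 (PImp P1 P0)) (nth A [:: B; A]));
  first truth_table.
Qed.

Lemma deduction Phi A B : Phi `<=` @Fm C -> Fm A ->
  derives L (Phi `|` [set A]) B -> derives L Phi (Imp A B).
Proof.
move=> FPhi FA; have FPhiA : Phi `|` [set A] `<=` @Fm C by move=> D [/FPhi|->].
elim=> {B} [B [PB|->]|B aB|B D _ dAB dBD dABD|B aB].
- by apply: derives_weaken => //; [apply: FPhi|apply: derives_hyp].
- by apply: (@derives_tautology _ (PImp P0 P0) (fun=> A)); first truth_table.
- by apply: derives_weaken; [|apply: axiom_Fm aB|apply: derives_axiom].
- have [FB FD] := derives_Fm FPhiA dBD.
  apply: derives_mp dAB _; apply: derives_mp dABD _.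
  by apply: (@derives_tautology _ (PImp (PImp P0 (PImp P1 P2))
    (PImp (PImp P0 P1) (PImp P0 P2))) (nth A [:: A; B; D])); first truth_table.
- by apply: derives_weaken; [|apply: axiom_Fm aB|apply: derives_nec].
Qed.

Lemma generalization Phi z A : Phi `<=` @Fm C ->
  (forall B, Phi B -> z \notin fv B) -> z \in fv A ->
  derives L Phi A -> derives L Phi (All z A).
Proof.
move=> FPhi zPhi zA dA; elim: dA zA => {A} [A /zPhi/negPf -> //|A aA zA|
    A B dA IHA dAB IHAB zB|A aA zA].
- exact/derives_axiom/axiom_all.
- have [FA FB] := derives_Fm FPhi dAB.
  have zAB : z \in fv A ++ fv B by rewrite mem_cat zB orbT.
  have [zA|zA] := boolP (z \in fv A).
    apply: derives_mp (IHA zA) _; apply: derives_mp (IHAB zAB) _.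
    by apply: derives_schema; last exact: sch_all_imp.
  apply: derives_mp dA _; apply: derives_mp (IHAB zAB) _.
  by apply: derives_schema; last exact: sch_all_const.
- have FA := axiom_Fm aA; have aAll : axiom L (All z A) by apply: axiom_all.
  apply: derives_mp (derives_nec Phi aAll) _.
  by apply: derives_schema; last exact: sch_cbarcan.
Qed.

Lemma generalization_fresh Phi x z A : Phi `<=` @Fm C ->
  (forall B, Phi B -> z \notin fv B) -> Fm A -> z \notin fv A -> x \in fv A ->
  derives L Phi (subst A x (Var z)) -> derives L Phi (All x A).
Proof.
move=> FPhi zPhi FA zA xA dAz.
have zAz : z \in fv (subst A x (Var z)) by apply: mem_fv_subst; rewrite ?inE.
have FAz : Fm (subst A x (Var z)) by apply: Fm_subst.
apply: derives_mp (generalization FPhi zPhi zAz dAz) _.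
have dEqv : derives L Phi (Eqv (All z (subst A x (Var z))) (All x A)).
  by apply: derives_schema => //; apply/sch_alpha/alpha_sym/alpha_rename.
apply: derives_mp dEqv _.
by apply: derives_schema => //; apply: sch_eqv_imp.
Qed.

Lemma derives_subst_fresh Phi x z A : Phi `<=` @Fm C ->
  (forall B, Phi B -> z \notin fv B) -> Fm A -> z \notin fv A ->
  derives L Phi (subst A x (Var z)) -> derives L Phi A.
Proof.
move=> FPhi zPhi FA zA; have [xA|/subst_notin -> //] := boolP (x \in fv A).
move=> /(generalization_fresh FPhi zPhi FA zA xA) dAll; apply: derives_mp dAll _.
rewrite -[X in Imp _ X](subst_Var A x).
by apply: derives_schema; [rewrite /= subst_Var|apply: sch_inst].
Qed.

(* The variables are renamed back one at a time, each by generalization,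
   alpha-conversion and instantiation. *)
Lemma derives_rename (r : nat -> nat) A : injective r ->
  (forall v, r v \notin fv A) -> (forall v, r v \notin bv A) -> Fm A ->
  derives L set0 (lsubst Cst (Var \o r) A) -> derives L set0 A.
Proof.
move=> r_inj r_fv r_bv FA.
suff unrename m : derives L set0 (lsubst Cst (Var \o rename_below r m) A) ->
    derives L set0 A.
  move=> dr; apply: (unrename (fresh (fv A))); rewrite (eq_lsubst (th' := Cst)
    (s' := Var \o r)) // => v vA; rewrite /= /rename_below ifT // ltnNge.
  by apply: contraL vA; apply: fresh_notin.
elim: m => [|m IH]; first by rewrite lsubst_id.
have [mA|mA] := boolP (m \in fv A); last first.
  rewrite (eq_lsubst (th' := Cst) (s' := Var \o rename_below r m)) // => v vA.
  by rewrite /= /rename_below ltnS leq_eqVlt; case: eqP vA mA => // -> ->.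
rewrite lsubst_rename_belowS // => dm; apply: IH; apply: derives_subst_fresh dm => //.
  exact: Fm_lsubst.
apply/negP => /fv_lsubst[[v vA]|[] //]; rewrite inE /rename_below => /eqP.
case: ifP => [lt_vm /r_inj mv|_ rv]; first by rewrite mv ltnn in lt_vm.
by move: vA; rewrite -rv (negPf (r_fv m)).
Qed.

Lemma derives_witness_elim Phi x z A B : Phi `<=` @Fm C ->
  (forall D, Phi D -> z \notin fv D) -> Fm A -> z \notin fv A -> x \in fv A ->
  Fm B -> z \notin fv B ->
  derives L (Phi `|` [set Imp (subst A x (Var z)) (All x A)]) B -> derives L Phi B.
Proof.
move=> FPhi zPhi FA zA xA FB zB; set Az := subst A x (Var z).
have FAz : Fm Az by apply: Fm_subst.
have FPhiN : Phi `|` [set Neg B] `<=` @Fm C by move=> D [/FPhi|->].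
have zPhiN D : (Phi `|` [set Neg B]) D -> z \notin fv D by case=> [/zPhi|->].
move=> /(deduction FPhi) -/(_ (conj FAz (conj xA FA))) dB.
have {}dB : derives L (Phi `|` [set Neg B]) (Imp (Imp Az (All x A)) B).
  by apply: derives_mono dB; apply: subsetUl.
have dAz : derives L (Phi `|` [set Neg B]) Az.
  apply: derives_mp (derives_hyp L _) _; first by right.
  apply: derives_mp dB _.
  by apply: (@derives_tautology _ (PImp (PImp (PImp P0 P1) P2) (PImp (PNeg P2) P0))
    (nth B [:: Az; All x A; B])); first truth_table.
have dNB : derives L (Phi `|` [set Neg B]) B.
  apply: derives_mp dB; apply: derives_weaken => //.
  exact: generalization_fresh zPhiN FA zA xA dAz.
apply: derives_mp (deduction FPhi _ dNB) _ => //.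
by apply: (@derives_tautology _ (PImp (PImp (PNeg P0) P0) P0) (fun=> B));
  first truth_table.
Qed.

End Derivations.

(** * Sentences *)

Definition sentence (C : constants) : set (form C) :=
  [set A | Fm A /\ fv A = [::]].

Definition unary (C : constants) (x : nat) : set (form C) :=
  [set A | Fm A /\ {subset fv A <= [:: x]}].

Section Sentences.
Variable C : constants.
Implicit Types (A B : form C) (x : nat).

Lemma sentenceP A : sentence A <-> Fm A /\ forall v, v \notin fv A.
Proof.
split=> -[FA hA]; split=> //; first by move=> v; rewrite hA.
by case: (fv A) hA => // v l /(_ v); rewrite inE eqxx.
Qed.

Lemma sentence_Fm A : sentence A -> Fm A. Proof. by case. Qed.

Lemma sentence_fv A v : sentence A -> v \notin fv A.
Proof. by move=> [_ ->]. Qed.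

Lemma free_for_sentence (D : constants) (A : form D) B : sentence B -> free_for B A.
Proof. by move=> sB y _; apply: sentence_fv. Qed.

Lemma sentence_un u A : sentence A -> sentence (un u A).
Proof. by rewrite /sentence /= Fm_un fv_un. Qed.

Lemma sentence_bin o A B : sentence (bin o A B) <-> sentence A /\ sentence B.
Proof.
rewrite /sentence /= Fm_bin fv_bin; split=> [[[FA FB]]|[[FA ->] [FB ->]] //].
by case: (fv A) => //; case: (fv B).
Qed.

Lemma sentence_Neg A : sentence A -> sentence (Neg A).
Proof. exact: (@sentence_un UNeg). Qed.

Lemma sentence_Box A : sentence A -> sentence (Box A).
Proof. exact: (@sentence_un UBox). Qed.

Lemma sentence_Imp A B : sentence A -> sentence B -> sentence (Imp A B).
Proof. by move=> sA sB; apply/(sentence_bin BImp). Qed.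

Lemma sentence_Eqv A B : sentence A -> sentence B -> sentence (Eqv A B).
Proof. by move=> sA sB; apply/(sentence_bin BEqv). Qed.

Lemma sentence_pinst (s : nat -> form C) p :
  (forall i, sentence (s i)) -> sentence (pinst s p).
Proof.
move=> ss; elim: p => //= [p sp q sq|p sp q sq|p sp q sq].
- exact/(sentence_bin BImp).
- exact/(sentence_bin BOr).
- exact/(sentence_bin BAnd).
Qed.

Lemma sentence_All x A : sentence (All x A) <-> x \in fv A /\ unary x A.
Proof.
split=> [/sentenceP[[xA FA] closedA]|[xA [FA subA]]].
  split=> //; split=> // v vA; rewrite inE; have := closedA v.
  by rewrite mem_filter vA andbT negbK.
apply/sentenceP; split=> // v; rewrite mem_filter; apply/negP => /andP[vx /subA].
by rewrite inE (negPf vx).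
Qed.

Lemma unary_Var x : unary x (Var x : form C).
Proof. by split. Qed.

Lemma unary_bin o x A B : unary x (bin o A B) <-> unary x A /\ unary x B.
Proof.
rewrite /unary /= Fm_bin fv_bin; split=> [[[FA FB] sub]|[[FA subA] [FB subB]]].
  by split; split=> // v vAB; apply: sub; rewrite mem_cat vAB ?orbT.
by split=> // v; rewrite mem_cat => /orP[/subA|/subB].
Qed.

Lemma sentence_unary x A : sentence A -> unary x A.
Proof. by move=> [FA fA]; split; rewrite // fA. Qed.

Lemma sentence_subst x A B : unary x A -> sentence B -> sentence (subst A x B).
Proof.
move=> [FA subA] sB; apply/sentenceP; split.
  exact: Fm_subst (sentence_Fm sB).
move=> u; apply/negP => /fv_subst[|[/subA]].
  by rewrite (negPf (sentence_fv u sB)).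
by rewrite inE => ->.
Qed.

Lemma sentence_All_rename x z A :
  sentence (All x A) -> sentence (All z (subst A x (Var z))).
Proof.
move=> /sentence_All[xA [FA subA]]; apply/sentence_All.
split; first by apply: mem_fv_subst; rewrite // inE.
split=> [|v /fv_subst[|[/subA]]] //; first exact: Fm_subst.
by rewrite inE => ->.
Qed.

End Sentences.

#[local] Hint Resolve sentence_Neg sentence_Box sentence_Imp sentence_Eqv : core.

(** * Henkin constants *)

(* [henkin_const] contains a copy of the syntax of the formulas over
   [C + henkin_const]; the code of [All x A] serves as the witness of
   [All x A], and [KVar v] also stands for the free variable [v]. *)
Inductive henkin_const (C : Type) : Type :=
| KVar of nat
| KCst of C
| KNew of henkin_const C
| KNeg of henkin_const C
| KImp of henkin_const C & henkin_const C
| KOr of henkin_const C & henkin_const C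
| KAnd of henkin_const C & henkin_const C
| KEqv of henkin_const C & henkin_const C
| KBox of henkin_const C
| KAll of nat & henkin_const C.

Arguments KVar {C} _.

HB.instance Definition _ (C : Type) := gen_eqMixin (henkin_const C).

Fixpoint ksize (C : Type) (k : henkin_const C) : nat :=
  match k with
  | KVar _ | KCst _ => 0
  | KNew k | KNeg k | KBox k | KAll _ k => (ksize k).+1
  | KImp k l | KOr k l | KAnd k l | KEqv k l => (ksize k + ksize l).+1
  end.

Definition henkin_constants (C : constants) : constants :=
  @Constants (C + henkin_const C)%type (inl (ctop C)) (inl (cbot C))
    (fun e => ctop_neq_cbot (f_equal
       (fun c : C + henkin_const C => if c is inl d then d else ctop C) e)).

Fixpoint code (C : constants) (A : form (henkin_constants C)) : henkin_const C :=
  match A with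
  | Var x => KVar x
  | Cst (inl c) => KCst c
  | Cst (inr k) => KNew k
  | Neg A => KNeg (code A)
  | Imp A B => KImp (code A) (code B)
  | Or A B => KOr (code A) (code B)
  | And A B => KAnd (code A) (code B)
  | Eqv A B => KEqv (code A) (code B)
  | Box A => KBox (code A)
  | All x A => KAll x (code A)
  end.

(* A naming [rho] replaces each Henkin constant by a variable. *)
Definition large_namings (C : Type) : set_system (henkin_const C -> nat) :=
  filter_from setT (fun n => [set rho | forall k, n <= rho k]).

Arguments large_namings {C}.

#[global] Instance large_namings_filter (C : Type) : Filter (large_namings (C := C)).
Proof.
apply: filter_fromT_filter; first by exists 0.
move=> m n; exists (maxn m n) => rho large_rho.
by split=> k; apply: leq_trans (large_rho k); rewrite ?leq_maxl ?leq_maxr.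
Qed.

Section HenkinExtension.
Variable C : constants.
Local Notation K := (henkin_const C).
Local Notation HC := (henkin_constants C).
Local Notation HForm := (form HC).
Implicit Types (A B : HForm) (k : K) (rho : K -> nat).

Lemma code_inj : injective (@code C).
Proof.
elim=> [x|[c|k]|A IH|A IHA B IHB|A IHA B IHB|A IHA B IHB|A IHA B IHB|A IH|x A IH]
  [y|[d|l]|A'|A' B'|A' B'|A' B'|A' B'|A'|y A'] //= [].
1-3: by move=> ->.
- by move=> /IH ->.
1-4: by move=> /IHA -> /IHB ->.
- by move=> /IH ->.
by move=> -> /IH ->.
Qed.

Lemma ksize_occurs k A : occurs (inr k : HC) A -> ksize k < ksize (code A).
Proof.
elim/form_connective_ind: A => [x|[c|l]|[] A IH|[] A B IHA IHB|x A IH] //=.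
- by case=> ->.
1-2: by move=> /IH; lia.
1-4: by case=> [/IHA|/IHB]; lia.
by move=> /IH; lia.
Qed.

Lemma near_large_notin (s : seq nat) :
  \forall rho \near large_namings, forall k : K, rho k \notin s.
Proof. by exists (fresh s) => // rho large_rho k; apply: fresh_notin. Qed.

Lemma near_large_update (P : set (K -> nat)) k : large_namings P ->
  \forall rho \near large_namings,
    exists n, forall z, n <= z -> P [eta rho with k |-> z].
Proof.
move=> [n _ nP]; exists n => // rho large_rho; exists n => z le_nz.
by apply: nP => l /=; case: eqP.
Qed.

Definition named_cst rho (c : HC) : form C :=
  match c with inl d => Cst d | inr k => Var (rho k) end.

Definition unhenkin rho : HForm -> form C := lsubst (named_cst rho) Var.

Definition embed (s : nat -> HForm) : form C -> HForm :=
  lsubst (fun c => Cst (inl c : HC)) s.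

Definition close_vars : form C -> HForm :=
  embed (fun v => Cst (inr (KVar v) : HC)).

Definition witness x A : HForm := Cst (inr (KAll x (code A)) : HC).

Definition witness_formula x A : HForm :=
  Imp (subst A x (witness x A)) (All x A).

Lemma unhenkin_All rho x A : unhenkin rho (All x A) = All x (unhenkin rho A).
Proof. by rewrite /unhenkin /= upd_id. Qed.

Lemma unhenkin_pinst rho s p :
  unhenkin rho (pinst s p) = pinst (unhenkin rho \o s) p.
Proof.
by elim: p => //= [p <-|p <- q <-|p <- q <-|p <- q <-].
Qed.

Lemma Fm_unhenkin rho A : Fm A -> Fm (unhenkin rho A).
Proof. by move=> FA; apply: Fm_lsubst => // -[]. Qed.

Lemma bv_unhenkin rho A : bv (unhenkin rho A) = bv A.
Proof. by apply: bv_lsubst => // -[]. Qed.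

Lemma fv_unhenkin rho A u : u \in fv (unhenkin rho A) ->
  u \in fv A \/ exists k, u = rho k.
Proof.
move=> /fv_lsubst[[v vA]|[[c|k] //]]; first by rewrite inE => /eqP ->; left.
by rewrite inE => /eqP ->; right; exists k.
Qed.

Lemma mem_fv_unhenkin rho A u : u \in fv A -> u \in fv (unhenkin rho A).
Proof. exact: mem_fv_lsubst. Qed.

Lemma eq_unhenkin rho rho' A :
  (forall k, occurs (inr k : HC) A -> rho k = rho' k) ->
  unhenkin rho A = unhenkin rho' A.
Proof. by move=> e; apply: eq_lsubst => // -[c|k] //= /e ->. Qed.

(* Large names are neither captured nor substituted for, so that no
   substitution involved renames a bound variable. *)
Lemma near_unhenkin_subst A x B : free_for B A ->
  \forall rho \near large_namings,
    unhenkin rho (subst A x B) = subst (unhenkin rho A) x (unhenkin rho B).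
Proof.
move=> fB; apply: filterS (near_large_notin (x :: bv A)) => rho rho_notin.
have rho_x k : rho k != x by have := rho_notin k; rewrite inE negb_or => /andP[].
have rho_bv k : rho k \notin bv A.
  by have := rho_notin k; rewrite inE negb_or => /andP[].
have fB' : free_for (unhenkin rho B) (unhenkin rho A).
  rewrite /free_for bv_unhenkin => y yA; apply/negP => /fv_unhenkin[|[k yk]].
    by rewrite (negPf (fB y yA)).
  by move: (rho_bv k); rewrite -yk yA.
rewrite !subst_lsubst // /unhenkin !lsubst_comp; last exact: no_capture_subst.
  by apply: eq_lsubst => [[c|k] _|v _] //=; [rewrite upd_neq|rewrite /upd; case: eqP].
by split=> [[c|k]|v _] //=; [apply: free_for_Var|left].
Qed.

Lemma near_unhenkin_witness_formula x A : \forall rho \near large_namings,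
  unhenkin rho (witness_formula x A) =
  Imp (subst (unhenkin rho A) x (Var (rho (KAll x (code A)))))
      (All x (unhenkin rho A)).
Proof.
have fw : free_for (witness x A) A by [].
apply: filterS (near_unhenkin_subst x fw) => rho substE.
by rewrite -unhenkin_All -[Var _]/(unhenkin rho (witness x A)) -substE.
Qed.

Lemma sentence_witness_formula x A :
  sentence (All x A) -> sentence (witness_formula x A).
Proof.
move=> sA; have [_ uA] := (sentence_All x A).1 sA.
by apply/(sentence_bin BImp); split=> //; apply: sentence_subst.
Qed.

Lemma occurs_witness_formula x A c : occurs c (witness_formula x A) ->
  occurs c A \/ c = inr (KAll x (code A)).
Proof. by case=> [/occurs_subst[]|]; [|left|right|left]. Qed.

Lemma sentence_embed s (A : form C) :
  Fm A -> (forall v, sentence (s v)) -> sentence (embed s A).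
Proof.
move=> FA ss; apply/sentenceP; split.
  by apply: Fm_lsubst => // v; apply: sentence_Fm.
move=> u; apply/negP => /fv_lsubst[[v _]|[]//].
by rewrite (negPf (sentence_fv u (ss v))).
Qed.

Lemma unary_embed s x (A : form C) : Fm A -> (forall v, sentence (s v)) ->
  unary x (embed (upd s x (Var x)) A).
Proof.
move=> FA ss; split.
  by apply: Fm_lsubst => // v; rewrite /upd; case: eqP => // _; apply: sentence_Fm.
move=> u /fv_lsubst[[v _]|[] //]; rewrite /upd; case: eqP => // _.
by rewrite (negPf (sentence_fv u (ss v))).
Qed.

Lemma subst_embed s x (A : form C) B : (forall v, sentence (s v)) -> sentence B ->
  subst (embed (upd s x (Var x)) A) x B = embed (upd s x B) A.
Proof.
move=> ss sB; rewrite subst_lsubst; last exact: free_for_sentence.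
rewrite lsubst_comp; last first.
  split=> // v _; rewrite /upd; case: eqP => [->|_]; first by left.
  by right; apply: free_for_sentence.
apply: eq_lsubst => // v _ /=.
have [->|vx] := eqVneq v x; first by rewrite !upd_eq /= upd_eq.
by rewrite !upd_neq //; apply: lsubst_id => u; rewrite (negPf (sentence_fv u (ss v))).
Qed.

Lemma sentence_close_vars (A : form C) : Fm A -> sentence (close_vars A).
Proof. by move=> FA; apply: sentence_embed. Qed.

Lemma occurs_close_vars x k (A : form C) :
  ~ occurs (inr (KAll x k) : HC) (close_vars A).
Proof. by move=> /occurs_lsubst[[]|[]]. Qed.

Lemma unhenkin_close_vars rho (A : form C) :
  unhenkin rho (close_vars A) = lsubst Cst (Var \o rho \o KVar) A.
Proof.
by rewrite /unhenkin /close_vars lsubst_comp //; split=> // v _; right.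
Qed.

End HenkinExtension.

(** * Henkin theories *)

Section Provability.
Variables (C : constants) (L : system).
Local Notation HC := (henkin_constants C).
Local Notation HForm := (form HC).
Implicit Types (S : set HForm) (A B D : HForm) (l : seq HForm).

Definition near_schema A : Prop :=
  \forall rho \near large_namings, schema L (unhenkin rho A).

Definition provable S A : Prop := exists2 l : seq HForm, [set` l] `<=` S &
  \forall rho \near large_namings,
    derives L (unhenkin rho @` [set` l]) (unhenkin rho A).

Lemma near_schema_tautology p s : tautology p -> near_schema (pinst s p).
Proof.
by move=> taut; apply: nearW => rho; rewrite unhenkin_pinst; apply: sch_taut.
Qed.

Lemma near_schema_eqv_subst x A B B' : x \in fv A -> sentence B -> sentence B' ->
  near_schema (Imp (Eqv B B') (Eqv (subst A x B) (subst A x B'))).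
Proof.
move=> xA /(@free_for_sentence HC HC A) fB /(@free_for_sentence HC HC A) fB'.
apply: filterS2 (near_unhenkin_subst x fB) (near_unhenkin_subst x fB') => rho E E'.
have -> : unhenkin rho (Imp (Eqv B B') (Eqv (subst A x B) (subst A x B'))) =
    Imp (Eqv (unhenkin rho B) (unhenkin rho B'))
      (Eqv (unhenkin rho (subst A x B)) (unhenkin rho (subst A x B'))) by [].
by rewrite E E'; apply/sch_eqv_subst/mem_fv_unhenkin.
Qed.

Lemma near_schema_inst x A B : sentence B ->
  near_schema (Imp (All x A) (subst A x B)).
Proof.
move=> /(@free_for_sentence HC HC A) fB.
apply: filterS (near_unhenkin_subst x fB) => rho E.
have -> : unhenkin rho (Imp (All x A) (subst A x B)) =
    Imp (unhenkin rho (All x A)) (unhenkin rho (subst A x B)) by [].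
by rewrite unhenkin_All E; apply: sch_inst.
Qed.

Lemma near_schema_eqv_rename x z A : z \notin fv A -> z \notin bv A ->
  near_schema (Eqv (All x A) (All z (subst A x (Var z)))).
Proof.
move=> zA /(@free_for_Var HC HC) fz.
apply: filterS2 (near_unhenkin_subst x fz) (@near_large_notin C [:: z]) => rho E rho_z.
have -> : unhenkin rho (Eqv (All x A) (All z (subst A x (Var z)))) =
    Eqv (unhenkin rho (All x A)) (unhenkin rho (All z (subst A x (Var z)))) by [].
rewrite !unhenkin_All E; apply/sch_alpha/alpha_rename.
apply/negP => /fv_unhenkin[|[k zk]]; first by rewrite (negPf zA).
by have := rho_z k; rewrite -zk inE eqxx.
Qed.

Lemma near_schema_eqv_all x A B :
  near_schema (Imp (All x (Eqv A B)) (Eqv (All x A) (All x B))).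
Proof. by apply: nearW => rho; rewrite /unhenkin /= upd_id; apply: sch_eqv_all. Qed.

Lemma near_schema_all_imp x A B :
  near_schema (Imp (All x (Imp A B)) (Imp (All x A) (All x B))).
Proof. by apply: nearW => rho; rewrite /unhenkin /= upd_id; apply: sch_all_imp. Qed.

Lemma near_schema_all_const x A B : sentence A ->
  near_schema (Imp (All x (Imp A B)) (Imp A (All x B))).
Proof.
move=> sA; apply: filterS (@near_large_notin C [:: x]) => rho rho_x.
rewrite /unhenkin /= upd_id; apply: sch_all_const.
apply/negP => /fv_unhenkin[|[k xk]]; first by rewrite (negPf (sentence_fv x sA)).
by have := rho_x k; rewrite -xk inE eqxx.
Qed.

Lemma near_schema_cbarcan x A : near_schema (Imp (Box (All x A)) (All x (Box A))).
Proof. by apply: nearW => rho; rewrite /unhenkin /= upd_id; apply: sch_cbarcan. Qed.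

Lemma near_schema_barcan x A : near_schema (Imp (All x (Box A)) (Box (All x A))).
Proof. by apply: nearW => rho; rewrite /unhenkin /= upd_id; apply: sch_barcan. Qed.

Lemma provable_mono S S' A : S `<=` S' -> provable S A -> provable S' A.
Proof. by move=> sub [l lS dA]; exists l => // B /lS/sub. Qed.

Lemma provable_finite S A :
  provable S A -> exists2 l : seq HForm, [set` l] `<=` S & provable [set` l] A.
Proof. by move=> [l lS dA]; exists l => //; exists l. Qed.

Lemma provable_hyp S A : S A -> provable S A.
Proof.
move=> SA; exists [:: A] => [B|]; first by rewrite /= inE => /eqP ->.
by apply: nearW => rho; apply: derives_hyp; exists A; rewrite //= inE.
Qed.

Lemma provable_schema S A :
  Fm A -> near_schema A -> provable S A /\ provable S (Box A).
Proof.
move=> FA sA; have aA : \forall rho \near large_namings, axiom L (unhenkin rho A).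
  by apply: filterS sA => rho; apply: axiom_schema; apply: Fm_unhenkin.
by split; exists [::] => //; apply: filterS aA => rho; [apply: derives_axiom|
  apply: derives_nec].
Qed.

Lemma provable_tautology S p s :
  tautology p -> Fm (pinst s p) -> provable S (pinst s p).
Proof.
by move=> taut Fp; have [] := provable_schema S Fp (near_schema_tautology s taut).
Qed.

Lemma provable_mp S A B : provable S A -> provable S (Imp A B) -> provable S B.
Proof.
move=> [l lS dA] [l' lS' dAB]; exists (l ++ l').
  by move=> D /=; rewrite mem_cat => /orP[/lS|/lS'].
apply: filterS2 dA dAB => rho dA dAB.
by apply: derives_mp (derives_mono _ dA) (derives_mono _ dAB); apply: image_subset => D;
  rewrite /= mem_cat => ->; rewrite ?orbT.
Qed.

Lemma provable_add_hyp S A B : provable (S `|` [set A]) B ->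
  exists2 l : seq HForm, [set` l] `<=` S & \forall rho \near large_namings,
    derives L (unhenkin rho @` [set` l] `|` [set unhenkin rho A]) (unhenkin rho B).
Proof.
move=> [l lSA dB]; exists [seq D <- l | D != A] => [D|].
  rewrite /= mem_filter => /andP[DA /lSA[//|DA']].
  by rewrite DA' eqxx in DA.
apply: filterS dB => rho; apply: derives_mono => _ [D lD <-].
have [->|DA] := eqVneq D A; [by right|left].
by exists D; rewrite //= mem_filter DA.
Qed.

Lemma Fm_image_unhenkin rho l :
  [set` l] `<=` @Fm HC -> unhenkin rho @` [set` l] `<=` @Fm C.
Proof. by move=> Fl _ [D lD <-]; apply/Fm_unhenkin/Fl. Qed.

Lemma provable_deduction S A B : S `<=` @Fm HC -> Fm A ->
  provable (S `|` [set A]) B -> provable S (Imp A B).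
Proof.
move=> FS FA /provable_add_hyp[l lS dB]; exists l => //.
apply: filterS dB => rho; apply: deduction; last exact: Fm_unhenkin.
by apply: Fm_image_unhenkin => D /lS/FS.
Qed.

Lemma provable_witness_elim S x A B :
  S `<=` @sentence HC -> sentence (All x A) -> sentence B ->
  (forall D, S D -> ~ occurs (inr (KAll x (code A)) : HC) D) ->
  ~ occurs (inr (KAll x (code A)) : HC) B ->
  provable (S `|` [set witness_formula x A]) B -> provable S B.
Proof.
set w := KAll x (code A) => sS sA sB wS wB /provable_add_hyp[l lS dB].
exists l => //; have [xA [FA _]] := (sentence_All x A).1 sA.
have wA : ~ occurs (inr w : HC) A by move=> /ksize_occurs /=; lia.
apply: filterS (near_large_update w
  (filterI (near_unhenkin_witness_formula x A) dB)) => rho [n dz].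
pose vars := fv (unhenkin rho A) ++ fv (unhenkin rho B) ++
  flatten [seq fv (unhenkin rho D) | D <- l].
pose z := maxn n (fresh vars); pose rho' := [eta rho with w |-> z].
have rho'_w : rho' w = z by rewrite /rho' /= eqxx.
have unhenkin_rho' D : ~ occurs (inr w : HC) D -> unhenkin rho' D = unhenkin rho D.
  by move=> wD; apply: eq_unhenkin => k /=; case: eqP => // ->.
have : z \notin vars by apply: fresh_notin; rewrite leq_maxr.
rewrite !mem_cat !negb_or => /and3P[zA zB zl].
have [witness_formulaE {}dB] := dz z (leq_maxl _ _).
rewrite -/rho' rho'_w !(unhenkin_rho' A wA) in witness_formulaE.
rewrite -/rho' (unhenkin_rho' B wB) witness_formulaE in dB.
apply: (derives_witness_elim _ _ (Fm_unhenkin rho FA) zA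
  (mem_fv_unhenkin rho xA) (Fm_unhenkin rho (sentence_Fm sB)) zB).
- by apply: Fm_image_unhenkin => D /lS/sS/sentence_Fm.
- move=> _ [D lD <-]; apply: contra zl => zD; apply/flattenP.
  by exists (fv (unhenkin rho D)) => //; apply: map_f.
apply: derives_mono dB => _ [[D lD <-]|->]; [left|by right].
by exists D; rewrite // unhenkin_rho' //; apply/wS/lS.
Qed.

Lemma provable_set0_close_vars (A : form C) : Fm A ->
  provable set0 (close_vars A) -> derives L set0 A.
Proof.
move=> FA [l l0 [n _ dn]]; pose N := maxn n (fresh (fv A ++ bv A)).
pose rho (k : henkin_const C) := if k is KVar v then v + N else N.
have large_rho k : N <= rho k by case: k => *; rewrite ?leq_addl.
have rho_notin v : rho (KVar v) \notin fv A ++ bv A.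
  by apply: fresh_notin; apply: leq_trans (large_rho _); rewrite leq_maxr.
apply: (@derives_rename _ _ (rho \o KVar)) => //.
- by move=> u v /addIn.
- by move=> v; have := rho_notin v; rewrite mem_cat negb_or => /andP[].
- by move=> v; have := rho_notin v; rewrite mem_cat negb_or => /andP[].
rewrite -unhenkin_close_vars.
have := dn rho (fun k => leq_trans (leq_maxl _ _) (large_rho k)).
by apply: derives_mono => E [D /l0].
Qed.

End Provability.

Section HenkinTheories.
Variables (C : constants) (L : system).
Local Notation HC := (henkin_constants C).
Local Notation HForm := (form HC).

Record henkin_theory (T : set HForm) : Prop := HenkinTheory {
  theory_sentence : T `<=` @sentence HC;
  theory_schema : forall A, sentence A -> near_schema L A -> T A /\ T (Box A);
  theory_mp : forall A B, T (Imp A B) -> T A -> T B;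
  theory_consistent : ~ T (Cst (cbot HC));
  theory_complete : forall A, sentence A -> T A \/ T (Neg A);
  theory_all : forall x A, sentence (All x A) ->
    (forall B, sentence B -> T (subst A x B)) -> T (All x A) }.

Definition witness_formulas (n : nat) : set HForm :=
  [set D | exists x A,
    [/\ sentence (All x A), ksize (code A) < n & D = witness_formula x A]].

Section Conservativity.
Variable Phi : set (form C).
Hypothesis FPhi : Phi `<=` @Fm C.
Implicit Types (A B : form C) (n : nat).

Definition henkin_stage n : set HForm :=
  @close_vars C @` Phi `|` witness_formulas n.

Definition henkin_base : set HForm := \bigcup_n henkin_stage n.

Lemma henkin_stage_sentence n : henkin_stage n `<=` @sentence HC.
Proof.
move=> _ [[B /FPhi FB <-]|[x [A [sA _ ->]]]]; first exact: sentence_close_vars.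
exact: sentence_witness_formula.
Qed.

Lemma henkin_stage_le m n : m <= n -> henkin_stage m `<=` henkin_stage n.
Proof.
move=> le_mn; apply: setUS => D [x [A [sA lt_m ->]]].
by exists x, A; split=> //; apply: leq_trans le_mn.
Qed.

Lemma occurs_henkin_stage n D x (A : HForm) :
  henkin_stage n D -> n <= (ksize (code A)).+1 ->
  occurs (inr (KAll x (code A)) : HC) D -> D = witness_formula x A.
Proof.
move=> [[B _ <-] _ /occurs_close_vars //|[y [B [_ lt_n ->]]] le_n].
by move=> /occurs_witness_formula[/ksize_occurs /=|[-> /code_inj ->] //]; lia.
Qed.

(* A witness of maximal size occurs in no other premise. *)
Lemma provable_stage_pred n A : Fm A ->
  provable L (henkin_stage n.+1) (close_vars A) ->
  provable L (henkin_stage n) (close_vars A).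
Proof.
move=> FA /provable_finite[l lS dA].
have {dA} : provable L (henkin_stage n `|` [set` l]) (close_vars A).
  by apply: provable_mono dA; apply: subsetUr.
elim: l lS => [|D l IH]; first by rewrite set_nil setU0.
rewrite set_cons subUset => -[lS /(_ D erefl) SD]; rewrite setUA.
set S := _ `|` [set` l] => dA; apply: IH => //.
have [SD'|nSD] := pselect (S D); first by apply: provable_mono dA => E [|->].
have sS : S `<=` henkin_stage n.+1.
  by move=> E [|/lS //]; apply: henkin_stage_le.
case: SD nSD dA => [PD|[x [B [sB lt_B ->]]]] nSD; first by case: nSD; left; left.
have le_nB : n <= ksize (code B).
  by rewrite leqNgt; apply/negP => lt_Bn; apply: nSD; left; right; exists x, B.
apply: provable_witness_elim => //.
- by move=> E /sS/henkin_stage_sentence.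
- exact: sentence_close_vars.
- by move=> E SE /(occurs_henkin_stage (sS _ SE)) EB; apply: nSD; rewrite -EB.
- exact: occurs_close_vars.
Qed.

Lemma provable_base A : Fm A -> provable L henkin_base (close_vars A) ->
  provable L (@close_vars C @` Phi) (close_vars A).
Proof.
move=> FA /provable_finite[l lS dA].
have [_ [n _ <-] lSn] : exists2 S, range henkin_stage S & [set` l] `<=` S.
  apply: finite_subset_chain; first by exists (henkin_stage 0), 0.
    move=> _ _ [m _ <-] [n _ <-].
    by case/orP: (leq_total m n) => /henkin_stage_le; [left|right].
  by rewrite bigcup_image.
have {l lS dA lSn} := provable_mono lSn dA.
elim: n => [|n IH /(provable_stage_pred FA)//]; apply: provable_mono.
by move=> D [//|[x [B []]]].
Qed.

Lemma derives_of_provable A : Fm A ->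
  provable L (@close_vars C @` Phi) (close_vars A) -> derives L Phi A.
Proof.
move=> FA /provable_finite[l]; elim: l A FA => [|D l IH] A FA.
  rewrite set_nil => _ /(provable_set0_close_vars FA).
  by apply: derives_mono => B [].
rewrite set_cons subUset => -[lPhi /(_ D erefl)[B PB DB]] dA; have FB := FPhi PB.
apply: derives_mp (derives_hyp L PB) _; apply: IH => //.
apply: (@provable_deduction _ _ _ (close_vars B) (close_vars A)); last by rewrite DB.
  by move=> E /lPhi[B' /FPhi FB' <-]; apply/sentence_Fm/sentence_close_vars.
exact/sentence_Fm/sentence_close_vars.
Qed.

End Conservativity.

Section MaximalTheory.
Variables (T : set HForm) (f : HForm).
Hypotheses (sT : T `<=` @sentence HC) (sf : sentence f).
Hypotheses (T_f : ~ provable L T f).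
Hypothesis T_max : forall A, sentence A -> ~ T A -> provable L (T `|` [set A]) f.
Implicit Types A B : HForm.

Lemma maximal_refutes A : sentence A -> ~ T A -> provable L T (Imp A f).
Proof.
move=> sA nA; apply: provable_deduction (T_max sA nA); last exact: sentence_Fm.
by move=> B /sT/sentence_Fm.
Qed.

Lemma maximal_closed A : sentence A -> provable L T A -> T A.
Proof.
move=> sA dA; apply: contrapT => nA; apply: T_f.
exact: provable_mp dA (maximal_refutes sA nA).
Qed.

Lemma maximal_tautology p s :
  tautology p -> (forall i, sentence (s i)) -> provable L T (pinst s p).
Proof. by move=> taut ss; apply/provable_tautology/sentence_Fm/sentence_pinst. Qed.

Lemma maximal_consistent : ~ T (Cst (cbot HC)).
Proof.
move=> /(provable_hyp L) dbot; apply: T_f; apply: provable_mp dbot _.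
by apply: (@maximal_tautology (PImp PBot P0) (fun=> f)).
Qed.

Lemma maximal_complete A : sentence A -> T A \/ T (Neg A).
Proof.
move=> sA; have [|/(maximal_refutes sA) dA] := pselect (T A); [by left|right].
apply: contrapT => /(maximal_refutes (@sentence_un _ UNeg _ sA)) dN; apply: T_f.
apply: provable_mp dN _; apply: provable_mp dA _.
apply: (@maximal_tautology (PImp (PImp P0 P1) (PImp (PImp (PNeg P0) P1) P1))
  (nth f [:: A])) => [|[|i]] //; last by rewrite nth_default.
truth_table.
Qed.

End MaximalTheory.

Lemma henkin_theory_exists (Phi : set (form C)) (phi : form C) :
  Phi `<=` @Fm C -> Fm phi -> ~ derives L Phi phi ->
  exists T, [/\ henkin_theory T, Phi `<=` @close_vars C @^-1` T &
    ~ T (close_vars phi)].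
Proof.
move=> FPhi Fphi nphi; set f := close_vars phi.
have sf : sentence f by apply: sentence_close_vars.
have [T [baseT sT T_f T_max]] : exists T : set HForm,
    [/\ henkin_base Phi `<=` T, T `<=` @sentence HC, ~ provable L T f &
      forall A, sentence A -> ~ T A -> provable L (T `|` [set A]) f].
  apply: (@finitary_maximal_extension _ (provable L ^~ f)).
  - by move=> S S'; apply: provable_mono.
  - by move=> S; apply: provable_finite.
  - by move=> A [n _] /(henkin_stage_sentence FPhi).
  - by move=> /(provable_base FPhi Fphi)/(derives_of_provable FPhi Fphi).
have closed := maximal_closed sT T_f T_max.
have baseP n D : henkin_stage Phi n D -> provable L T D.
  by move=> SD; apply/provable_hyp/baseT; exists n.
exists T; split; last by move=> /(provable_hyp L).
  split=> //.
  - move=> A sA /(provable_schema T (sentence_Fm sA))[dA dBA].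
    by split; apply: closed => //; apply: (@sentence_un _ UBox).
  - move=> A B TAB TA; have /(sentence_bin BImp)[_ sB] := sT _ TAB.
    exact: closed sB (provable_mp (provable_hyp L TA) (provable_hyp L TAB)).
  - exact: maximal_consistent sf T_f.
  - exact: (maximal_complete sT sf T_f T_max).
  - move=> x A sA TA; apply: closed => //.
    apply: provable_mp (provable_hyp L (TA (witness x A) _)) _ => //.
    by apply: (baseP (ksize (code A)).+1); right; exists x, A.
by move=> B PB; apply: baseT; exists 0 => //; left; exists B.
Qed.

End HenkinTheories.

(** * The canonical model *)

Section TheoryCalculus.
Variables (C : constants) (L : system) (T : set (form (henkin_constants C))).
Hypothesis hT : henkin_theory L T.
Local Notation HC := (henkin_constants C).
Local Notation HForm := (form HC).
Implicit Types A B D : HForm.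

Lemma theory_tautology p s : tautology p -> (forall i, sentence (s i)) ->
  T (pinst s p) /\ T (Box (pinst s p)).
Proof.
move=> taut ss; apply: (theory_schema hT); first exact: sentence_pinst.
exact: near_schema_tautology.
Qed.

Lemma theory_schema_mp A B : sentence A -> sentence B ->
  near_schema L (Imp A B) -> T A -> T B.
Proof.
move=> sA sB sAB; apply: (theory_mp hT).
by have [] := theory_schema hT (sentence_Imp sA sB) sAB.
Qed.

Lemma theory_box_elim A : sentence A -> T (Box A) -> T A.
Proof.
by move=> sA; apply: theory_schema_mp; auto; apply: nearW => rho; apply: sch_T.
Qed.

Lemma theory_box_mp A B : T (Box (Imp A B)) -> T (Box A) -> T (Box B).
Proof.
move=> TAB; have sAB : sentence (Box (Imp A B)) := theory_sentence hT TAB.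
have [sA sB] := (sentence_bin BImp A B).1 sAB.
apply: (theory_mp hT); apply: theory_schema_mp TAB => //.
by apply: nearW => rho; apply: sch_K.
Qed.

Lemma theory_eqv_sentence A B : T (Eqv A B) -> sentence A /\ sentence B.
Proof. by move=> /(theory_sentence hT)/(sentence_bin BEqv). Qed.

Lemma theory_eqv_refl A : sentence A -> T (Eqv A A) /\ T (Box (Eqv A A)).
Proof.
move=> sA; apply: (theory_schema hT); first by auto.
by apply: nearW => rho; apply/sch_alpha/alpha_refl.
Qed.

Lemma theory_eqv_mp A B : T (Eqv A B) -> T A -> T B.
Proof.
move=> TAB; have [sA sB] := theory_eqv_sentence TAB.
apply: (theory_mp hT); apply: theory_schema_mp TAB; auto.
by apply: nearW => rho; apply: sch_eqv_imp.
Qed.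

Lemma theory_eqv_subst x A B B' :
  unary x A -> T (Eqv B B') -> T (Eqv (subst A x B) (subst A x B')).
Proof.
move=> uA TB; have [sB sB'] := theory_eqv_sentence TB.
have sAB := sentence_subst uA sB; have sAB' := sentence_subst uA sB'.
have [xA|xA] := boolP (x \in fv A); last first.
  by rewrite !subst_notin // in sAB *; have [] := theory_eqv_refl sAB.
by apply: theory_schema_mp TB; auto; apply: near_schema_eqv_subst.
Qed.

Lemma theory_eqv_sym A B : T (Eqv A B) -> T (Eqv B A).
Proof.
move=> TAB; have [sA sB] := theory_eqv_sentence TAB.
have uA : unary 0 (Eqv (Var 0) A).
  by apply/(unary_bin BEqv); split; [exact: unary_Var|exact: sentence_unary].
have := theory_eqv_subst uA TAB; rewrite /subst /= -!/(subst A 0 _).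
rewrite !subst_notin ?sentence_fv // => /theory_eqv_mp; apply.
by have [] := theory_eqv_refl sA.
Qed.

Lemma theory_eqv_iff A B : T (Eqv A B) -> T A <-> T B.
Proof. by move=> TAB; split; apply: theory_eqv_mp => //; apply: theory_eqv_sym. Qed.

Lemma theory_eqv_trans A B D : T (Eqv A B) -> T (Eqv B D) -> T (Eqv A D).
Proof.
move=> TAB TBD; have [sA sB] := theory_eqv_sentence TAB.
have uA : unary 0 (Eqv A (Var 0)).
  by apply/(unary_bin BEqv); split; [exact: sentence_unary|exact: unary_Var].
have := theory_eqv_subst uA TBD; rewrite /subst /= -!/(subst A 0 _).
by rewrite !subst_notin ?sentence_fv // => /theory_eqv_mp; apply.
Qed.

Lemma theory_eqv_un u A A' : T (Eqv A A') -> T (Eqv (un u A) (un u A')).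
Proof.
have u0 : unary 0 (un u (Var 0) : HForm) by case: u; apply: unary_Var.
by move=> /(theory_eqv_subst u0); rewrite /subst !msubst_un /= !upd_eq.
Qed.

Lemma theory_eqv_bin o A A' B B' : T (Eqv A A') -> T (Eqv B B') ->
  T (Eqv (bin o A B) (bin o A' B')).
Proof.
move=> TA TB; have [sA sA'] := theory_eqv_sentence TA.
have [sB sB'] := theory_eqv_sentence TB.
have u1 : unary 0 (bin o (Var 0) B).
  by apply/unary_bin; split; [exact: unary_Var|exact: sentence_unary].
have u2 : unary 0 (bin o A' (Var 0)).
  by apply/unary_bin; split; [exact: sentence_unary|exact: unary_Var].
have := theory_eqv_subst u2 TB; have := theory_eqv_subst u1 TA.
rewrite /subst !msubst_bin -!/(subst B 0 _) -!/(subst A' 0 _) /= !upd_eq.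
by rewrite !subst_notin ?sentence_fv //; apply: theory_eqv_trans.
Qed.

Lemma theory_neg A : sentence A -> T (Neg A) <-> ~ T A.
Proof.
move=> sA; split=> [TN TA|]; last by have [] := theory_complete hT sA.
apply: (theory_consistent hT); apply: (theory_mp hT) TA; apply: (theory_mp hT) TN.
by have [] := @theory_tautology (PImp (PNeg P0) (PImp P0 PBot)) (fun=> A);
  first truth_table.
Qed.

Lemma theory_tautology2 A B p : sentence A -> sentence B -> tautology p ->
  T (pinst (nth A [:: A; B]) p).
Proof.
move=> sA sB taut; have ss i : sentence (nth A [:: A; B] i).
  by case: i => [|[|i]] //; rewrite nth_default.
by have [] := theory_tautology taut ss.
Qed.

Lemma theory_imp A B : sentence A -> sentence B -> T (Imp A B) <-> (T A -> T B).
Proof.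
move=> sA sB; have taut := theory_tautology2 sA sB.
split=> [TAB TA|TAB]; first exact: (theory_mp hT TAB TA).
have [/TAB TB|/(theory_neg sA) TN] := pselect (T A).
  by apply: (theory_mp hT) TB; apply: (taut (PImp P1 (PImp P0 P1))); truth_table.
by apply: (theory_mp hT) TN; apply: (taut (PImp (PNeg P0) (PImp P0 P1))); truth_table.
Qed.

Lemma theory_and A B : sentence A -> sentence B -> T (And A B) <-> T A /\ T B.
Proof.
move=> sA sB; have taut := theory_tautology2 sA sB.
split=> [TAB|[TA TB]].
  split; apply: (theory_mp hT) TAB.
    by apply: (taut (PImp (PAnd P0 P1) P0)); truth_table.
  by apply: (taut (PImp (PAnd P0 P1) P1)); truth_table.
apply: (theory_mp hT) TB; apply: (theory_mp hT) TA.
by apply: (taut (PImp P0 (PImp P1 (PAnd P0 P1)))); truth_table.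
Qed.

Lemma theory_or A B : sentence A -> sentence B -> T (Or A B) <-> T A \/ T B.
Proof.
move=> sA sB; have taut := theory_tautology2 sA sB.
split=> [TAB|[TA|TB]].
- have [|/(theory_neg sA) TN] := pselect (T A); [by left|right].
  apply: (theory_mp hT) TN; apply: (theory_mp hT) TAB.
  by apply: (taut (PImp (POr P0 P1) (PImp (PNeg P0) P1))); truth_table.
- by apply: (theory_mp hT) TA; apply: (taut (PImp P0 (POr P0 P1))); truth_table.
- by apply: (theory_mp hT) TB; apply: (taut (PImp P1 (POr P0 P1))); truth_table.
Qed.

Lemma theory_eqv_rename x z A : sentence (All x A) ->
  z \notin fv A -> z \notin bv A -> T (Eqv (All x A) (All z (subst A x (Var z)))).
Proof.
move=> sA zA zbv; have sAz := sentence_All_rename z sA.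
by have [] := theory_schema hT (sentence_Eqv sA sAz)
  (near_schema_eqv_rename L x zA zbv).
Qed.

End TheoryCalculus.

Section CanonicalModel.
Variables (C : constants) (L : system) (T : set (form (henkin_constants C))).
Hypothesis hT : henkin_theory L T.
Local Notation HC := (henkin_constants C).
Local Notation HForm := (form HC).
Implicit Types A B D : HForm.

Definition sentence_or_top A : HForm :=
  if `[< sentence A >] then A else Cst (ctop HC).

Lemma sentence_or_topP A : sentence (sentence_or_top A).
Proof. by rewrite /sentence_or_top; case: ifP => [/asboolP|]. Qed.

Lemma sentence_or_top_id A : sentence A -> sentence_or_top A = A.
Proof. by move=> sA; rewrite /sentence_or_top ifT //; apply/asboolP. Qed.

Definition provably_equal : rel HForm :=
  fun A B => `[< T (Eqv (sentence_or_top A) (sentence_or_top B)) >].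

Lemma provably_equal_refl : reflexive provably_equal.
Proof.
by move=> A; apply/asboolP; have [] := theory_eqv_refl hT (sentence_or_topP A).
Qed.

Lemma provably_equal_sym : symmetric provably_equal.
Proof. by move=> A B; apply/asboolP/asboolP; apply: theory_eqv_sym hT _ _. Qed.

Lemma provably_equal_trans : transitive provably_equal.
Proof.
by move=> B A D /asboolP TAB /asboolP TBD; apply/asboolP/(theory_eqv_trans hT TAB TBD).
Qed.

Canonical provably_equal_equiv := EquivRel provably_equal
  provably_equal_refl provably_equal_sym provably_equal_trans.

Definition proposition : Type := {eq_quot provably_equal_equiv}.

Definition cls A : proposition := \pi_{eq_quot provably_equal_equiv} A.

Definition rep (a : proposition) : HForm := sentence_or_top (repr a).

Lemma sentence_rep a : sentence (rep a).
Proof. exact: sentence_or_topP. Qed.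
#[local] Hint Resolve sentence_rep : core.

Lemma cls_eq A B : T (Eqv A B) -> cls A = cls B.
Proof.
move=> TAB; have [sA sB] := theory_eqv_sentence hT TAB.
by apply/eqmodP/asboolP; rewrite !sentence_or_top_id.
Qed.

Lemma rep_cls A : sentence A -> T (Eqv (rep (cls A)) A).
Proof.
move=> sA; have /eqmodP/asboolP :
    repr (cls A) = A %[mod {eq_quot provably_equal_equiv}] by rewrite reprK.
by rewrite (sentence_or_top_id sA).
Qed.

Lemma repK : cancel rep cls.
Proof.
move=> a; rewrite -[RHS](reprK a); apply/eqmodP/asboolP.
rewrite (sentence_or_top_id (sentence_rep a)).
by have [] := theory_eqv_refl hT (sentence_rep a).
Qed.

Lemma cls_eqP A B : sentence A -> sentence B -> cls A = cls B <-> T (Eqv A B).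
Proof.
move=> sA sB; split=> [AB|/cls_eq //].
apply: theory_eqv_trans hT _ _ _ _ (rep_cls sB); rewrite -AB.
exact: theory_eqv_sym hT _ _ (rep_cls sA).
Qed.

Lemma cls_ind (P : proposition -> Prop) :
  (forall A, sentence A -> P (cls A)) -> forall a, P a.
Proof. by move=> clsP a; rewrite -(repK a); apply: clsP. Qed.

Definition denotes (t : proposition -> proposition) (x : nat) A : Prop :=
  unary x A /\ forall a, t a = cls (subst A x (rep a)).

Definition cls_all (t : proposition -> proposition) : proposition :=
  match pselect (exists p : nat * HForm, p.1 \in fv p.2 /\ denotes t p.1 p.2) with
  | left e => let p := sval (cid e) in cls (All p.1 p.2)
  | right _ => t (cls (Cst (ctop HC)))
  end.

Definition canonical : domain C := {|
  dom := proposition;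
  TRUE := [set a | T (rep a)];
  NEC := [set a | T (Box (rep a))];
  f_bot := cls (Cst (cbot HC));
  f_top := cls (Cst (ctop HC));
  f_box := fun a => cls (Box (rep a));
  f_neg := fun a => cls (Neg (rep a));
  f_or := fun a b => cls (Or (rep a) (rep b));
  f_and := fun a b => cls (And (rep a) (rep b));
  f_imp := fun a b => cls (Imp (rep a) (rep b));
  f_eqv := fun a b => cls (Eqv (rep a) (rep b));
  f_all := cls_all;
  Gamma := fun c => cls (Cst (inl c : HC));
  Gamma_bot := erefl;
  Gamma_top := erefl |}.

Local Notation M := canonical.
Implicit Types (a b c : M) (t : M -> M) (g : nat -> M).

Lemma TRUE_cls A : sentence A -> TRUE M (cls A) <-> T A.
Proof. by move=> sA; apply: (theory_eqv_iff hT (rep_cls sA)). Qed.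

Lemma NEC_cls A : sentence A -> NEC M (cls A) <-> T (Box A).
Proof.
by move=> sA; apply: (theory_eqv_iff hT (theory_eqv_un hT UBox (rep_cls sA))).
Qed.

Lemma cls_un u A : sentence A -> f_un u (cls A : M) = cls (un u A).
Proof.
move=> sA; transitivity (cls (un u (rep (cls A)))); first by case: u.
exact/cls_eq/(theory_eqv_un hT)/rep_cls.
Qed.

Lemma cls_bin o A B : sentence A -> sentence B ->
  f_bin o (cls A : M) (cls B) = cls (bin o A B).
Proof.
move=> sA sB; transitivity (cls (bin o (rep (cls A)) (rep (cls B)))); first by case: o.
by apply/cls_eq/(theory_eqv_bin hT); apply: rep_cls.
Qed.

Lemma cls_neg A : sentence A -> f_neg (cls A : M) = cls (Neg A).
Proof. exact: (cls_un UNeg). Qed.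

Lemma cls_box A : sentence A -> f_box (cls A : M) = cls (Box A).
Proof. exact: (cls_un UBox). Qed.

Lemma cls_imp A B : sentence A -> sentence B ->
  f_imp (cls A : M) (cls B) = cls (Imp A B).
Proof. exact: (cls_bin BImp). Qed.

Lemma cls_eqv A B : sentence A -> sentence B ->
  f_eqv (cls A : M) (cls B) = cls (Eqv A B).
Proof. exact: (cls_bin BEqv). Qed.

Lemma leM_cls A B : sentence A -> sentence B ->
  leM (cls A : M) (cls B) <-> T (Box (Imp A B)).
Proof.
by move=> sA sB; rewrite /leM cls_imp //; apply: NEC_cls; auto.
Qed.

Lemma leM_schema A B : sentence A -> sentence B ->
  near_schema L (Imp A B) -> leM (cls A : M) (cls B).
Proof.
move=> sA sB sAB; apply/leM_cls => //.
by have [] := theory_schema hT (sentence_Imp sA sB) sAB.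
Qed.

Lemma canonical_NEC_mp a b : NEC M (f_imp a b) -> NEC M a -> NEC M b.
Proof.
elim/cls_ind: a => A sA; elim/cls_ind: b => B sB /(leM_cls sA sB) TAB.
by rewrite !NEC_cls //; apply: (theory_box_mp hT).
Qed.

Lemma cls_pinst (s : nat -> HForm) p : (forall i, sentence (s i)) ->
  pdenote (M := M) (cls \o s) p = cls (pinst s p).
Proof.
move=> ss; elim: p => //= [p ->|p -> q ->|p -> q ->|p -> q ->].
- by apply: (cls_un UNeg); apply: sentence_pinst.
- by apply: (cls_bin BImp); apply: sentence_pinst.
- by apply: (cls_bin BOr); apply: sentence_pinst.
- by apply: (cls_bin BAnd); apply: sentence_pinst.
Qed.

Lemma canonical_NEC_tautology (s : nat -> M) p : tautology p -> NEC M (pdenote s p).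
Proof.
move=> taut; have -> : s = cls \o (rep \o s) by apply: funext => i; rewrite /= repK.
have ss i : sentence ((rep \o s) i) by apply: sentence_rep.
rewrite cls_pinst //; apply/NEC_cls; first exact: sentence_pinst.
by have [] := theory_tautology hT taut ss.
Qed.

Lemma canonical_boolean : boolean_prealgebra M.
Proof.
exact: boolean_prealgebra_of_tautologies canonical_NEC_tautology canonical_NEC_mp.
Qed.

Lemma canonical_normal : normal M.
Proof. by exists (f_top M); apply: (@canonical_NEC_tautology (fun=> f_top M) PTop). Qed.

Lemma canonical_T a : leM (f_box a) a.
Proof.
rewrite -[a in X in leM _ X]repK; apply: (@leM_schema (Box (rep a))); auto.
by apply: nearW => rho; apply: sch_T.
Qed.

Lemma canonical_filter : nec_filter M.
Proof.
split=> [a|a b Na ab|a b Na Nb].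
- exact: (theory_box_elim hT (sentence_rep a)).
- exact: canonical_NEC_mp ab Na.
apply: canonical_NEC_mp Nb; apply: canonical_NEC_mp Na.
by apply: (@canonical_NEC_tautology (nth a [:: a; b])
  (PImp P0 (PImp P1 (PAnd P0 P1)))); truth_table.
Qed.

Let bpM := canonical_boolean.
Let leMM a : leM a a := bp_refl bpM a.
Let leM_trans a b c : leM a b -> leM b c -> leM a c := @bp_trans _ _ bpM a b c.
Let leM_NEC a b : NEC M b -> leM a b :=
  @leM_NEC _ M canonical_NEC_tautology canonical_NEC_mp a b.
Let leM_f_imp a a' b b' : leM a' a -> leM b b' -> leM (f_imp a b) (f_imp a' b') :=
  @leM_f_imp _ M canonical_NEC_tautology canonical_NEC_mp a a' b b'.

Lemma leM_TRUE a b : leM a b -> TRUE M a -> TRUE M b.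
Proof.
elim/cls_ind: a => A sA; elim/cls_ind: b => B sB /(leM_cls sA sB) TAB.
rewrite !TRUE_cls //; apply: (theory_mp hT); apply: (theory_box_elim hT) TAB.
by auto.
Qed.

Lemma denotes_cls t x A B : denotes t x A -> sentence B ->
  t (cls B) = cls (subst A x B).
Proof.
by move=> [uA ->] sB; apply/cls_eq/(theory_eqv_subst hT) => //; apply: rep_cls.
Qed.

Lemma denotes_const (b : M) x : denotes (fun=> b) x (rep b).
Proof.
split=> [|a]; first exact: sentence_unary.
by rewrite subst_notin ?repK // sentence_fv.
Qed.

Lemma denotes_notin t x A : denotes t x A -> x \notin fv A -> t = fun=> cls A.
Proof. by move=> [_ tA] xA; apply: funext => a; rewrite tA subst_notin. Qed.

Lemma denotes_un u t x A : denotes t x A -> denotes (fun a => f_un u (t a)) x (un u A).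
Proof.
move=> [uA tA]; split=> [|a]; first by rewrite /unary /= Fm_un fv_un.
by rewrite tA cls_un /subst ?msubst_un //; apply: sentence_subst.
Qed.

Lemma denotes_bin o t1 t2 x A B : denotes t1 x A -> denotes t2 x B ->
  denotes (fun a => f_bin o (t1 a) (t2 a)) x (bin o A B).
Proof.
move=> [uA tA] [uB tB]; split=> [|a]; first exact/unary_bin.
by rewrite tA tB cls_bin /subst ?msubst_bin //; apply: sentence_subst.
Qed.

Lemma denotes_rename t x z A : denotes t x A -> x \in fv A ->
  z \notin fv A -> z \notin bv A -> denotes t z (subst A x (Var z)).
Proof.
move=> [uA tA] xA zA zbv; have sA := (sentence_All x A).2 (conj xA uA).
split=> [|a]; first by have [] := (sentence_All z _).1 (sentence_All_rename z sA).
by rewrite subst_rename // => y _; apply: sentence_fv.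
Qed.

Lemma sentence_All_denotes t x A :
  x \in fv A -> denotes t x A -> sentence (All x A).
Proof. by move=> xA [uA _]; apply/sentence_All. Qed.

Lemma cls_All_eq_var t x A B : denotes t x A -> denotes t x B ->
  x \in fv A -> x \in fv B -> cls (All x A) = cls (All x B).
Proof.
move=> tA tB xA xB; apply: cls_eq.
have [sA sB] := (sentence_All_denotes xA tA, sentence_All_denotes xB tB).
have sE : sentence (All x (Eqv A B)).
  apply/sentence_All; split; first by rewrite mem_cat xA.
  by apply/(unary_bin BEqv); split; [case: tA|case: tB].
suff : T (All x (Eqv A B)).
  by apply: (theory_schema_mp hT); auto; apply: near_schema_eqv_all.
apply: (theory_all hT) => // D sD.
apply/cls_eqP; [exact: sentence_subst tA.1 sD|exact: sentence_subst tB.1 sD|].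
by rewrite -(denotes_cls tA sD) -(denotes_cls tB sD).
Qed.

Lemma cls_All_eq t x A y B : denotes t x A -> denotes t y B ->
  x \in fv A -> y \in fv B -> cls (All x A) = cls (All y B).
Proof.
move=> tA tB xA yB; pose z := fresh (fv A ++ bv A ++ fv B ++ bv B).
have : z \notin fv A ++ bv A ++ fv B ++ bv B by apply: fresh_notin.
rewrite !mem_cat !negb_or => /and4P[zA zbA zB zbB].
rewrite (cls_eq (theory_eqv_rename hT (sentence_All_denotes xA tA) zA zbA)).
rewrite (cls_eq (theory_eqv_rename hT (sentence_All_denotes yB tB) zB zbB)).
apply: (cls_All_eq_var (denotes_rename tA xA zA zbA) (denotes_rename tB yB zB zbB));
  by apply: mem_fv_subst; rewrite // inE.
Qed.

Lemma f_all_denotes t x A :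
  x \in fv A -> denotes t x A -> f_all t = cls (All x A) :> M.
Proof.
move=> xA tA; rewrite /= /cls_all; case: pselect => [e|[]]; last by exists (x, A).
by case: (cid e) => -[y B] /= [yB tB]; apply: (cls_All_eq tB tA).
Qed.

Lemma leM_inst_free t x A a :
  x \in fv A -> denotes t x A -> leM (f_all t) (t a).
Proof.
move=> xA tA; rewrite (f_all_denotes xA tA) tA.2.
have sA := sentence_All_denotes xA tA; apply: leM_schema => //.
  exact: sentence_subst tA.1 (sentence_rep a).
exact: near_schema_inst.
Qed.

Lemma leM_all_const_free t x A (b : M) : x \in fv A -> denotes t x A ->
  leM (f_all (fun a => f_imp b (t a))) (f_imp b (f_all t)).
Proof.
move=> xA tA; have tbA := denotes_bin BImp (denotes_const b x) tA.
have xbA : x \in fv (bin BImp (rep b) A) by rewrite fv_bin mem_cat xA orbT.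
rewrite (f_all_denotes xbA tbA) (f_all_denotes xA tA) -[b in f_imp b _]repK.
have sA := sentence_All_denotes xA tA; rewrite cls_imp //.
apply: leM_schema; first exact: sentence_All_denotes xbA tbA.
  exact: sentence_Imp.
exact: near_schema_all_const.
Qed.

Lemma NEC_all_free t x A : x \in fv A -> denotes t x A ->
  (forall a, NEC M (t a)) -> NEC M (f_all t).
Proof.
move=> xA tA Nt; have sA := sentence_All_denotes xA tA.
rewrite (f_all_denotes xA tA); apply/NEC_cls => //.
suff : T (All x (Box A)).
  by apply: (theory_schema_mp hT); auto; apply: near_schema_barcan.
apply: (theory_all hT) => // B sB; have := Nt (cls B); rewrite (denotes_cls tA sB).
by move=> /NEC_cls; apply; apply: sentence_subst tA.1 sB.
Qed.

Lemma f_all_const (b : M) : eqM (f_all (fun=> b)) b.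
Proof.
have [[[x A] /= [xA bA]]|nfree] := pselect (exists p : nat * HForm,
    p.1 \in fv p.2 /\ denotes (fun=> b) p.1 p.2); last first.
  by rewrite /= /cls_all; case: pselect => // e; split; apply: leMM.
split; first exact: leM_inst_free (f_top M) xA bA.
apply: canonical_NEC_mp (leM_all_const_free b xA bA) _.
have bbA := denotes_bin BImp (denotes_const b x) bA.
by apply: NEC_all_free bbA _ => [|a]; [rewrite fv_bin mem_cat xA orbT|apply: leMM].
Qed.

Lemma leM_inst t x A a : denotes t x A -> leM (f_all t) (t a).
Proof.
have [xA|xA] := boolP (x \in fv A); first exact: leM_inst_free.
by move=> /denotes_notin -> //; case: (f_all_const (cls A)).
Qed.

Lemma den_cls s (A : form C) : Fm A -> (forall v, sentence (s v)) ->
  den (cls \o s : nat -> M) A = cls (embed s A).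
Proof.
elim/form_connective_ind: A s => [x|c|u A IH|o A B IHA IHB|x A IH] s FA ss //.
- move: FA; rewrite Fm_un => FA; rewrite den_un IH //.
  by rewrite cls_un ?/embed ?lsubst_un //; apply: sentence_embed.
- move: FA; rewrite Fm_bin => -[FA FB]; rewrite den_bin IHA // IHB //.
  by rewrite cls_bin ?/embed ?lsubst_bin //; apply: sentence_embed.
case: FA => xA FA; have : denotes (fun a => den (upd (cls \o s) x a : nat -> M) A) x
    (embed (upd s x (Var x)) A).
  split=> [|a]; first exact: unary_embed.
  rewrite subst_embed // -IH // => [|v]; last by rewrite /upd; case: eqP.
  by apply: (eq_den (M := M)) => v _; rewrite /= /upd; case: eqP => // _; rewrite repK.
move=> /f_all_denotes; apply.
by apply: mem_fv_lsubst; rewrite // upd_eq.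
Qed.

Lemma definable_by_denotes (A : form C) x g t : definable_by A x g t ->
  exists2 A', (x \in fv A -> x \in fv A') & denotes t x A'.
Proof.
move=> [FA tA]; have sg v : sentence ((rep \o g) v) by apply: sentence_rep.
exists (embed (upd (rep \o g) x (Var x)) A).
  by move=> xA; apply: mem_fv_lsubst; rewrite // upd_eq.
split=> [|a]; first exact: unary_embed.
rewrite tA subst_embed // -den_cls // => [|v].
  by apply: (eq_den (M := M)) => v _; rewrite /= /upd; case: eqP => _; rewrite repK.
by rewrite /upd; case: eqP.
Qed.

Lemma definable_denotes t : definable t -> exists x A, denotes t x A.
Proof. by move=> [A [x [g /definable_by_denotes[A' _ tA']]]]; exists x, A'. Qed.

Lemma canonical_truth : truth_conditions M.
Proof.
split.
- by move=> /TRUE_cls Tbot; apply: (theory_consistent hT); apply: Tbot.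
- apply/TRUE_cls => //.
  by have [] := @theory_tautology _ _ _ hT PTop (fun=> Cst (ctop HC)).
- by move=> a b; rewrite TRUE_cls; auto; apply: (theory_imp hT).
- by move=> a; rewrite TRUE_cls; auto; apply: (theory_neg hT).
- by move=> a b; rewrite TRUE_cls; [apply: (theory_and hT)|apply/(sentence_bin BAnd)].
- by move=> a b; rewrite TRUE_cls; [apply: (theory_or hT)|apply/(sentence_bin BOr)].
- by move=> a; rewrite TRUE_cls; auto.
- by move=> a b; rewrite TRUE_cls -?cls_eqP ?repK; auto.
move=> t /definable_denotes[x [A tA]] Tt.
have [xA|xA] := boolP (x \in fv A); last first.
  move: Tt; rewrite (denotes_notin tA xA) => /(_ (f_top M)).
  by apply: leM_TRUE; case: (f_all_const (cls A)).
rewrite (f_all_denotes xA tA); apply/TRUE_cls; first exact: sentence_All_denotes xA tA.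
apply: (theory_all hT); first exact: sentence_All_denotes xA tA.
move=> B sB; have := Tt (cls B); rewrite (denotes_cls tA sB) => /TRUE_cls; apply.
exact: sentence_subst tA.1 sB.
Qed.

Lemma NEC_eqv_refl a : NEC M (f_eqv a a).
Proof. by apply/NEC_cls; auto; have [] := theory_eqv_refl hT (sentence_rep a). Qed.

Lemma canonical_eqv_imp a b : leM (f_eqv a b) (f_imp a b).
Proof.
elim/cls_ind: a => A sA; elim/cls_ind: b => B sB; rewrite cls_eqv // cls_imp //.
by apply: leM_schema; auto; apply: nearW => rho; apply: sch_eqv_imp.
Qed.

Lemma canonical_eqv_subst t a b : definable t -> leM (f_eqv a b) (f_eqv (t a) (t b)).
Proof.
move=> /definable_denotes[x [A tA]]; have [xA|xA] := boolP (x \in fv A); last first.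
  by rewrite (denotes_notin tA xA); apply/leM_NEC/NEC_eqv_refl.
elim/cls_ind: a => B sB; elim/cls_ind: b => D sD.
have [sAB sAD] := (sentence_subst tA.1 sB, sentence_subst tA.1 sD).
rewrite (denotes_cls tA sB) (denotes_cls tA sD) !cls_eqv //.
by apply: leM_schema; auto; apply: near_schema_eqv_subst.
Qed.

Lemma canonical_K a b : leM (f_box (f_imp a b)) (f_imp (f_box a) (f_box b)).
Proof.
elim/cls_ind: a => A sA; elim/cls_ind: b => B sB.
rewrite cls_imp // !cls_box ?cls_imp; auto.
by apply: leM_schema; auto; apply: nearW => rho; apply: sch_K.
Qed.

Lemma canonical_S3 a b :
  leM (f_box (f_imp a b)) (f_box (f_imp (f_box a) (f_box b))).
Proof.
elim/cls_ind: a => A sA; elim/cls_ind: b => B sB.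
rewrite cls_imp // (cls_box sA) (cls_box sB) cls_imp ?cls_box; auto.
by apply: leM_schema; auto; apply: nearW => rho; apply: sch_S3.
Qed.

Lemma leM_box a b : leM a b -> leM (f_box a) (f_box b).
Proof.
elim/cls_ind: a => A sA; elim/cls_ind: b => B sB /(leM_cls sA sB) TAB.
rewrite !cls_box // leM_cls; auto.
by apply: (theory_schema_mp hT) TAB; auto; apply: nearW => rho; apply: sch_S3.
Qed.

Lemma canonical_all_eqv (A B : form C) x g t1 t2 : x \in fv A -> x \in fv B ->
  definable_by A x g t1 -> definable_by B x g t2 ->
  leM (f_all (fun a => f_eqv (t1 a) (t2 a))) (f_eqv (f_all t1) (f_all t2)).
Proof.
move=> xA xB /definable_by_denotes[A' /(_ xA) xA' tA'].
move=> /definable_by_denotes[B' /(_ xB) xB' tB'].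
have tAB := denotes_bin BEqv tA' tB'.
have xAB : x \in fv (bin BEqv A' B') by rewrite fv_bin mem_cat xA'.
have [sA sB] := (sentence_All_denotes xA' tA', sentence_All_denotes xB' tB').
rewrite (f_all_denotes xAB tAB) (f_all_denotes xA' tA') (f_all_denotes xB' tB').
rewrite cls_eqv //; apply: leM_schema; auto; first exact: sentence_All_denotes xAB tAB.
exact: near_schema_eqv_all.
Qed.

Lemma leM_all_imp t1 t2 x A B : denotes t1 x A -> denotes t2 x B ->
  leM (f_all (fun a => f_imp (t1 a) (t2 a))) (f_imp (f_all t1) (f_all t2)).
Proof.
move=> tA tB; have tAB := denotes_bin BImp tA tB.
have [xB|xB] := boolP (x \in fv B); last first.
  apply: leM_trans (leM_inst (f_top M) tAB) _; apply: leM_f_imp => //.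
    exact: leM_inst tA.
  by rewrite (denotes_notin tB xB); case: (f_all_const (cls B)).
have [xA|xA] := boolP (x \in fv A); last first.
  have leA := leM_inst (f_top M) tA; rewrite (denotes_notin tA xA) in leA *.
  exact: leM_trans (leM_all_const_free (cls A) xB tB) (leM_f_imp leA (leMM _)).
have xAB : x \in fv (bin BImp A B) by rewrite fv_bin mem_cat xA.
have [sA sB] := (sentence_All_denotes xA tA, sentence_All_denotes xB tB).
rewrite (f_all_denotes xAB tAB) (f_all_denotes xA tA) (f_all_denotes xB tB).
rewrite cls_imp //; apply: leM_schema; auto; first exact: sentence_All_denotes xAB tAB.
exact: near_schema_all_imp.
Qed.

Lemma leM_all_const t (b : M) : definable t ->
  leM (f_all (fun a => f_imp b (t a))) (f_imp b (f_all t)).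
Proof.
move=> /definable_denotes[x [A tA]]; have [xA|xA] := boolP (x \in fv A).
  exact: leM_all_const_free xA tA.
rewrite (denotes_notin tA xA).
have [leb _] := f_all_const (f_imp b (cls A)); apply: leM_trans leb _.
by apply: leM_f_imp; [apply: leMM|case: (f_all_const (cls A))].
Qed.

Lemma canonical_barcan t : definable t ->
  eqM (f_box (f_all t)) (f_all (fun a => f_box (t a))).
Proof.
move=> /definable_denotes[x [A tA]]; have [xA|xA] := boolP (x \in fv A); last first.
  rewrite (denotes_notin tA xA); set b : M := cls A.
  have [[leb geb] [lebox gebox]] := (f_all_const b, f_all_const (f_box b)).
  by split; [apply: leM_trans (leM_box leb) gebox|apply: leM_trans lebox (leM_box geb)].
have tBA := denotes_un UBox tA; have xBA : x \in fv (un UBox A) by [].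
have [sA sBA] := (sentence_All_denotes xA tA, sentence_All_denotes xBA tBA).
rewrite (f_all_denotes xA tA) (f_all_denotes xBA tBA) cls_box //.
split; apply: leM_schema; auto; [exact: near_schema_cbarcan|exact: near_schema_barcan].
Qed.

Lemma canonical_all_nec t :
  definable t -> (forall a, NEC M (t a)) -> NEC M (f_all t).
Proof.
move=> /definable_denotes[x [A tA]]; have [xA|xA] := boolP (x \in fv A).
  exact: NEC_all_free xA tA.
rewrite (denotes_notin tA xA) => /(_ (f_top M)) NA.
by have [_ geA] := f_all_const (cls A); apply: canonical_NEC_mp geA NA.
Qed.

Lemma canonical_nec : nec_conditions M.
Proof.
split.
- by move=> a; apply/leM_NEC/NEC_eqv_refl.
- exact: canonical_eqv_imp.
- exact: canonical_eqv_subst.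
- exact: canonical_T.
- exact: canonical_K.
- exact: canonical_S3.
- exact: canonical_all_eqv.
- move=> A B x g t1 t2 /definable_by_denotes[A' _ tA'] /definable_by_denotes[B' _ tB'].
  exact: leM_all_imp tA' tB'.
- by move=> t a /definable_denotes[x [A]]; apply: leM_inst.
- move=> A B x g b t _ _ _ tB; apply: leM_all_const; by exists B, x, g.
- exact: canonical_barcan.
- exact: canonical_all_nec.
Qed.

Lemma canonical_S3_model : S3_model M.
Proof.
split=> [_||_|_].
- exact: canonical_boolean.
- exact: canonical_truth.
- exact: canonical_filter.
- exact: canonical_nec.
Qed.

Lemma canonical_S4_model : L <> S3 -> S4_model M.
Proof.
move=> L3; split=> [||a]; [exact: canonical_S3_model|exact: canonical_normal|].
elim/cls_ind: a => A sA; rewrite !cls_box; auto.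
by apply: leM_schema; auto; apply: nearW => rho; apply: sch_4.
Qed.

Lemma canonical_S5_model : L = S5 -> S5_model M.
Proof.
move=> L5; split=> [|a]; first by apply: canonical_S4_model; rewrite L5.
elim/cls_ind: a => A sA; rewrite cls_box // cls_neg ?cls_box; auto.
by apply: leM_schema; auto; apply: nearW => rho; apply: sch_5.
Qed.

Lemma canonical_model : model_of L M.
Proof.
move: canonical_S3_model canonical_S4_model canonical_S5_model.
by case: L => h3 h4 h5; [exact: h3|exact: h4|exact: h5].
Qed.

Lemma canonical_satisfies (A : form C) : Fm A ->
  satisfies (cls \o (fun v => Cst (inr (KVar v) : HC)) : nat -> M) A <->
  T (close_vars A).
Proof.
by move=> FA; rewrite /satisfies den_cls // TRUE_cls //; apply: sentence_close_vars.
Qed.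

End CanonicalModel.

(** * Completeness *)

Lemma completeness (C : constants) L (Phi : set (form C)) (phi : form C) :
  Phi `<=` @Fm C -> Fm phi -> entails L Phi phi -> derives L Phi phi.
Proof.
move=> FPhi Fphi ent; apply: contrapT => nphi.
have [T [hT PhiT nT]] := henkin_theory_exists FPhi Fphi nphi.
apply: nT; apply/(canonical_satisfies hT) => //; apply: ent.
- exact: canonical_model.
- exact: canonical_normal.
- by move=> B PB; apply/(canonical_satisfies hT); [apply: FPhi|apply: PhiT].
Qed.

Theorem theorem28 (C : constants) (Phi : set (form C)) (phi : form C)
    (hPhi : forall psi : form C, Phi psi -> Fm psi) (hphi : Fm phi) :
  (entails S3 Phi phi <-> derives S3 Phi phi) /\
  (entails S4 Phi phi <-> derives S4 Phi phi) /\
  (entails S5 Phi phi <-> derives S5 Phi phi).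
Proof.
by split; [|split]; split; do [exact: completeness|exact: soundness].
Qed.
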